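(* Let $w(e^{it})=4\sum_{k\ge1}c_k\sin^2(kt/2)$ with $c_k\ge0$, $0<\sum_{k\ge1}c_k<\infty$, be such that $1/w\in L^1(\mathbb{T})$, and let $D=\mathcal{F}L^2(\mathbb{T},w)$ be the associated Besov–Dirichlet sequence space, with capacity $\mathrm{Cap}(\cdot)$. Let $\nu=(\nu_k)_{k\in\mathbb{Z}}$ be a nonnegative sequence. Then the inequality $$\sum_{k\in\mathbb{Z}}|x_k|^2\nu_k\le C\,\|x\|_D^2$$ holds for all $x\in D$ (with some constant $C$) if and only if $$\sum_{k\in J}\nu_k\le C_1\,\mathrm{Cap}(J)$$ for every finite set $J\subset\mathbb{Z}$ (with some constant $C_1$). Moreover, the best constants in these two inequalities satisfy $C_1\le C\le 4C_1$.
   Context: $\mathbb{T}$ is the unit circle, $m$ normalized Lebesgue measure, $\mathcal{F}f=(\hat f(n))_{n\in\mathbb{Z}}$ the Fourier transform. Since $1/w\in L^1(\mathbb{T})$, $L^2(\mathbb{T},w\,dm)\subset L^1(\mathbb{T})$, so $D=\mathcal{F}L^2(\mathbb{T},w)$ is a space of sequences on $\mathbb{Z}$, normed by $\|\mathcal{F}f\|_D=\|f\|_{L^2(w)}=\big(\int_{\mathbb{T}}|f|^2w\,dm\big)^{1/2}$; for finitely supported $x$ one has $\|x\|_D^2=\frac12\sum_{j,k\in\mathbb{Z}}c_{|j-k|}|x_j-x_k|^2$ (with $c_0=0$), and $D$ is the completion of the finitely supported sequences in this norm. The capacity of a nonempty set $J\subset\mathbb{Z}$ is $\mathrm{Cap}(J)=\inf\{\|x\|_D^2:\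 x\in D,\ x_j\ge1\text{ for all }j\in J\}$ (with $\mathrm{Cap}(J)=\infty$ if there is no such $x$). *)

(* Defs.v *)
From mathcomp Require Import all_boot all_order all_algebra.
From mathcomp Require Import all_classical all_reals all_analysis.
From mathcomp Require Export complex.

Set Implicit Arguments.
Unset Strict Implicit.
Unset Printing Implicit Defensive.

Import Order.TTheory GRing.Theory Num.Theory.
Import numFieldNormedType.Exports.

Local Open Scope classical_set_scope.
Local Open Scope ring_scope.
Local Open Scope complex_scope.

Section besov_dirichlet.
Context {R : realType}.

(* A function on the unit circle is given by its values at e^{it}, where t runs
   through [0, 2 pi[; values of t outside this interval are irrelevant. *)
Definition circle : set R := `[0, 2 * pi[.

Definition circle_measurable (f : R -> R[i]) : Prop :=
  measurable_fun circle (fun t => complex.Re (f t)) /\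
  measurable_fun circle (fun t => complex.Im (f t)).

(* Lebesgue integration on the circle is normalized: dm = dt / (2 pi). *)
Definition circle_int (f : R -> R[i]) : R[i] :=
  ((2 * pi)^-1 * \int[lebesgue_measure]_(t in circle) complex.Re (f t)) +i*
  ((2 * pi)^-1 * \int[lebesgue_measure]_(t in circle) complex.Im (f t)).

Definition circle_eint (g : R -> \bar R) : \bar R :=
  ((2 * pi)^-1%:E * \int[lebesgue_measure]_(t in circle) g t)%E.

Definition fourier (f : R -> R[i]) (n : int) : R[i] :=
  circle_int (fun t => f t * (cos (n%:~R * t) -i* sin (n%:~R * t))).

Definition L2w_norm_sq (w : R -> R) (f : R -> R[i]) : \bar R :=
  circle_eint (fun t => (Normc.normc (f t) ^+ 2 * w t)%:E).

Definition L2w (w : R -> R) : set (R -> R[i]) :=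
  [set f | circle_measurable f /\ (L2w_norm_sq w f < +oo)%E].

(* The inverse is that of \bar R, for which 1 / 0 = +oo. *)
Definition inv_integrable (w : R -> R) : Prop :=
  lebesgue_measure.-integrable circle (fun t => ((w t)%:E^-1)%E).

Definition Dspace (w : R -> R) : set (int -> R[i]) := fourier @` L2w w.

(* || F f ||_D^2 = || f ||_{L^2(w)}^2. When 1/w is integrable, f is determined
   almost everywhere by its Fourier coefficients, so that for x in D the
   infimum is over exactly one value; it is +oo for x outside D. *)
Definition Dnorm_sq (w : R -> R) (x : int -> R[i]) : \bar R :=
  ereal_inf [set L2w_norm_sq w f | f in [set f | L2w w f /\ fourier f = x]].

(* The order on R[i] is such that 1 <= z means that z is real and z >= 1.
   With this formula the capacity of the empty set is 0. *)
Definition capacity (w : R -> R) (J : set int) : \bar R :=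
  ereal_inf [set Dnorm_sq w x |
    x in [set x | Dspace w x /\ forall j, J j -> 1 <= x j]].

Definition weight (c : nat -> R) (t : R) : R :=
  4 * limn (fun n => \sum_(1 <= k < n) c k * sin (k%:R * t / 2) ^+ 2).

Definition embedding_ineq (w : R -> R) (nu : int -> R) (C : R) : Prop :=
  forall x : int -> R[i], Dspace w x ->
    (\esum_(k in [set: int]) (Normc.normc (x k) ^+ 2 * nu k)%:E
       <= C%:E * Dnorm_sq w x)%E.

Definition capacity_ineq (w : R -> R) (nu : int -> R) (C1 : R) : Prop :=
  forall J : set int, finite_set J ->
    ((\sum_(k \in J) nu k)%:E <= C1%:E * capacity w J)%E.

(* Equal to +oo when no constant is admissible. *)
Definition best_constant (P : R -> Prop) : \bar R :=
  ereal_inf [set C%:E | C in [set C | P C]].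

End besov_dirichlet.

(* Main.v *)
(* The easy half holds because an admissible [x] for the capacity of [J] has
   |x_j| >= 1 on [J].  For the converse, work with the Green function
   [green k], the [k]-th Fourier coefficient of [g = 1 / w].  If [p >= 0] is
   carried by a finite set [J] and has potential about 1 on [J], then
   [g(t) * \sum_j p_j e^{ijt}] is admissible for [J] up to a factor 1 + e, so
   Cap(J) <= (1 + O(e)) * p(J).  For [x = F f] let [p_t] be such a measure for
   {|x| >= t}, A = \int p_t(Z) d(t^2) and M = \int p_t dt.  Then
   A <= 2 <|x|, M>, while the nesting of the level sets gives
   energy(M) <= (1 + e) A.  Since [green >= 0], Cauchy-Schwarz in L^2(T) yields
   <|x|, M>^2 <= ||f||_w^2 * energy(M), hence A <= 4 (1 + e) ||f||_w^2.
   That [green >= 0] and that such measures exist follows from a minimum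
   principle on Z for the convolution operator of symbol [v], where [v] is a
   positive trigonometric polynomial with [v >= w]; letting [v] tend to [w],
   dominated convergence transfers both facts to [g]. *)

Require Import Defs.
From mathcomp Require Import all_boot all_order all_algebra.
From mathcomp Require Import all_classical all_reals all_analysis.
From mathcomp Require Import measurable_realfun ring lra.
Import Order.TTheory GRing.Theory Num.Theory.
Import numFieldNormedType.Exports.
Local Open Scope classical_set_scope.
Local Open Scope ring_scope.

(** * Means over the circle *)

Section mean.
Context {R : realType}.
Implicit Types (u v : R -> R) (k : int) (t : R).
Notation mu := lebesgue_measure.

Definition mean u : R := (2 * pi)^-1 * \int[mu]_(t in circle) u t.

Definition circle_integrable u : Prop := mu.-integrable circle (EFin \o u).

Lemma twopi_gt0 : 0 < 2 * pi :> R.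
Proof. by rewrite mulr_gt0// pi_gt0. Qed.

Lemma measurable_circle : measurable (circle : set R).
Proof. exact: measurable_itv. Qed.
Hint Resolve measurable_circle : core.

Lemma measure_circle : mu (circle : set R) = (2 * pi)%:E.
Proof. by rewrite /circle lebesgue_measure_itv/= lte_fin twopi_gt0 sube0. Qed.

Lemma circle_integrableD u v : circle_integrable u -> circle_integrable v ->
  circle_integrable (fun t => u t + v t).
Proof.
move=> iu iv; rewrite /circle_integrable.
rewrite (_ : _ \o _ = (EFin \o u) \+ (EFin \o v))%E//.
exact: integrableD.
Qed.

Lemma circle_integrableZ r u : circle_integrable u ->
  circle_integrable (fun t => r * u t).
Proof.
move=> iu; rewrite /circle_integrable.
rewrite (_ : _ \o _ = fun t => (r%:E * (EFin \o u) t)%E)//.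
exact: integrableZl.
Qed.

Lemma circle_integrable_sum (I : Type) (s : seq I) (P : pred I) (u : I -> R -> R) :
  (forall i, circle_integrable (u i)) ->
  circle_integrable (fun t => \sum_(i <- s | P i) u i t).
Proof.
move=> iu; have := @integrable_sum _ _ _ mu circle measurable_circle I s P
  (fun i => EFin \o u i) (fun i _ => iu i).
by apply: eq_integrable => // t _ /=; rewrite sumEFin.
Qed.

Lemma circle_integrable_bounded u B : measurable_fun circle u ->
  (forall t, `|u t| <= B) -> circle_integrable u.
Proof.
move=> mu_ uB; apply: measurable_bounded_integrable => //.
  by rewrite [X in (X < _)%E]measure_circle ltry.
exists B; split; first exact: num_real.
by move=> M BM t _ /=; rewrite (le_trans (uB t))// ltW.
Qed.

Lemma circle_integrable_le u v : measurable_fun circle u ->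
  circle_integrable v -> (forall t, `|u t| <= v t) -> circle_integrable u.
Proof.
move=> mu_ iv uv; apply: le_integrable iv => //; first exact/measurable_EFinP.
by move=> t _ /=; rewrite lee_fin (le_trans (uv t))// ler_norm.
Qed.

Lemma meanD u v : circle_integrable u -> circle_integrable v ->
  mean (fun t => u t + v t) = mean u + mean v.
Proof. by move=> iu iv; rewrite /mean RintegralD// mulrDr. Qed.

Lemma meanZ r u : circle_integrable u -> mean (fun t => r * u t) = r * mean u.
Proof. by move=> iu; rewrite /mean RintegralZl// mulrCA. Qed.

Lemma circle_integrableB u v : circle_integrable u -> circle_integrable v ->
  circle_integrable (fun t => u t - v t).
Proof.
move=> iu iv; rewrite /circle_integrable.
rewrite (_ : _ \o _ = (EFin \o u) \- (EFin \o v))%E//.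
exact: integrableB.
Qed.

Lemma meanB u v : circle_integrable u -> circle_integrable v ->
  mean (fun t => u t - v t) = mean u - mean v.
Proof. by move=> iu iv; rewrite /mean RintegralB// mulrBr. Qed.

Lemma mean_sum (I : Type) (s : seq I) (P : pred I) (u : I -> R -> R) :
  (forall i, circle_integrable (u i)) ->
  mean (fun t => \sum_(i <- s | P i) u i t) = \sum_(i <- s | P i) mean (u i).
Proof.
move=> iu; elim: s => [|i s IH].
  rewrite big_nil /mean (_ : (fun t => _) = cst 0).
    by rewrite Rintegral_cst// mul0r mulr0.
  by apply/funext => t; rewrite big_nil.
rewrite big_cons -IH; case: ifPn => Pi; last first.
  by congr mean; apply/funext => t; rewrite big_cons (negbTE Pi).
rewrite -meanD//; last exact: circle_integrable_sum.
by congr mean; apply/funext => t; rewrite big_cons Pi.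
Qed.

Lemma mean_le u v : circle_integrable u -> circle_integrable v ->
  (forall t, u t <= v t) -> mean u <= mean v.
Proof.
move=> iu iv uv; rewrite /mean ler_wpM2l ?invr_ge0 ?(ltW twopi_gt0)//.
exact: le_Rintegral.
Qed.

Lemma mean_cst r : mean (cst r) = r.
Proof.
rewrite /mean Rintegral_cst// [X in fine X]measure_circle mulrCA.
by rewrite mulVf ?mulr1 ?gt_eqF ?twopi_gt0.
Qed.

Lemma mean_ae_eq u v : measurable_fun circle u -> measurable_fun circle v ->
  ae_eq mu circle u v -> mean u = mean v.
Proof.
move=> mu_ mv uv; rewrite /mean /Rintegral; congr (_ * fine _).
apply: ae_eq_integral => //; [exact/measurable_EFinP..|].
by apply: (ae_eq_comp EFin); exact: uv.
Qed.

Lemma mean_normr_le u B : circle_integrable u -> (forall t, `|u t| <= B) ->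
  `|mean u| <= B.
Proof.
move=> iu uB; have ib r : circle_integrable (cst r).
  by apply: (@circle_integrable_bounded _ `|r|) => //; exact: measurable_cst.
rewrite ler_norml -{1}(mean_cst (- B)) -{2}(mean_cst B).
by apply/andP; split; apply: mean_le => // t /=;
  have := uB t; rewrite ler_norml => /andP[].
Qed.

(** Fundamental theorem of calculus over one period; it makes the nonconstant Fourier modes average
    to zero. *)
Lemma mean_derivative (F f : R -> R) :
  (forall t : R, is_derive t (1 : R) F (f t)) -> continuous f ->
  F (2 * pi) = F 0 -> mean f = 0.
Proof.
move=> dF cf F2pi.
have cF : continuous F.
  move=> t; apply/differentiable_continuous/derivable1_diffP.
  by have [] := dF t.
rewrite /mean /Rintegral integral_itv_bndo_bndc; last first.
  by apply/measurable_EFinP/measurable_funTS; exact: continuous_measurable_fun.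
rewrite (@continuous_FTC2 _ f F)//.
- by rewrite F2pi subee ?mulr0.
- exact: twopi_gt0.
- exact: continuous_subspaceT.
- split.
  + by move=> t _; have [] := dF t.
  + by apply: cvg_at_right_filter; exact: cF.
  + by apply: cvg_at_left_filter; exact: cF.
- by move=> t _; rewrite derive1E derive_val.
Qed.

Lemma sin2pi_int k : sin (k%:~R * (2 * pi) : R) = 0.
Proof.
case: k => n; rewrite ?NegzE ?mulrNz ?mulNr ?sinN.
- elim: n => [|n IH]; first by rewrite mul0r sin0.
  rewrite -[in X in X%:~R]addn1 PoszD rmorphD mulrDl mul1r sinD IH.
  by rewrite [2 * pi]mulr_natl sin2pi cos2pi; ring.
- elim: n.+1 => [|{}n IH]; first by rewrite mul0r sin0 oppr0.
  rewrite -[in X in X%:~R]addn1 PoszD rmorphD mulrDl mul1r sinD.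
  move/eqP: IH; rewrite oppr_eq0 => /eqP ->.
  by rewrite [2 * pi]mulr_natl sin2pi cos2pi; ring.
Qed.

Lemma cos2pi_int k : cos (k%:~R * (2 * pi) : R) = 1.
Proof.
suff nat n : cos (n%:Z%:~R * (2 * pi) : R) = 1.
  by case: k => n; rewrite ?NegzE ?mulrNz ?mulNr ?cosN nat.
elim: n => [|n IH]; first by rewrite mul0r cos0.
rewrite -[in X in X%:~R]addn1 PoszD rmorphD mulrDl mul1r cosD IH sin2pi_int.
by rewrite [2 * pi]mulr_natl cos2pi; ring.
Qed.

Lemma continuous_cosM (r : R) : continuous (fun t => cos (r * t)).
Proof.
move=> t; apply: continuous_comp; last exact: continuous_cos.
exact: mulrl_continuous.
Qed.

Lemma continuous_sinM (r : R) : continuous (fun t => sin (r * t)).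
Proof.
move=> t; apply: continuous_comp; last exact: continuous_sin.
exact: mulrl_continuous.
Qed.

Lemma mean_cos k : mean (fun t => cos (k%:~R * t)) = (k == 0)%:R.
Proof.
have [->|k0] := eqVneq k 0.
  rewrite -(mean_cst 1); congr mean; apply/funext => t.
  by rewrite mul0r cos0.
have kR0 : k%:~R != 0 :> R by rewrite intr_eq0.
apply: (@mean_derivative (fun t => (k%:~R)^-1 * sin (k%:~R * t))).
- move=> t; apply: is_derive_eq.
  rewrite /GRing.scale/=. field; exact: kR0.
- exact: continuous_cosM.
- by rewrite sin2pi_int !mulr0 sin0 mulr0.
Qed.

Lemma mean_sin k : mean (fun t => sin (k%:~R * t)) = 0.
Proof.
have [->|k0] := eqVneq k 0.
  rewrite -[RHS](mean_cst 0); congr mean; apply/funext => t.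
  by rewrite mul0r sin0.
have kR0 : k%:~R != 0 :> R by rewrite intr_eq0.
apply: (@mean_derivative (fun t => - (k%:~R)^-1 * cos (k%:~R * t))).
- move=> t; apply: is_derive_eq.
  rewrite /GRing.scale/=. field; exact: kR0.
- exact: continuous_sinM.
- by rewrite cos2pi_int !mulr0 cos0.
Qed.

End mean.

(** * Minimum principle and equilibrium measures on Z *)

Section minimum_principle.
Context {R : realType} (lam : R) (c : nat -> R) (n : nat).
Hypothesis lam_gt0 : 0 < lam.
Hypothesis c_ge0 : forall k, (1 <= k)%N -> 0 <= c k.

(* The convolution operator with symbol
   [lam + 4 * \sum_(1 <= j < n) c j * sin (j * t / 2) ^+ 2]. *)
Definition laplacian (h : int -> R) (k : int) : R :=
  lam * h k + \sum_(1 <= j < n) c j * (2 * h k - h (k + j%:Z) - h (k - j%:Z)).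

Lemma laplacian_sum (I : finType) (d : I -> R) (h : I -> int -> R) k :
  laplacian (fun k => \sum_i d i * h i k) k = \sum_i d i * laplacian (h i) k.
Proof.
rewrite /laplacian mulr_sumr; under [RHS]eq_bigr do rewrite mulrDr mulr_sumr.
rewrite big_split/=; congr (_ + _).
  by apply: eq_bigr => i _; rewrite mulrCA.
rewrite exchange_big/=; apply: eq_bigr => j _.
rewrite mulr_sumr -!sumrB mulr_sumr; apply: eq_bigr => i _; ring.
Qed.

Lemma laplacianN h k : laplacian (fun k => - h k) k = - laplacian h k.
Proof.
rewrite /laplacian opprD -sumrN mulrN; congr (_ + _).
by apply: eq_bigr => j _; ring.
Qed.

Lemma laplacian_1B h k : laplacian (fun k => 1 - h k) k = lam - laplacian h k.
Proof.
rewrite /laplacian opprD addrA -sumrN mulrBr mulr1; congr (_ + _).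
by apply: eq_bigr => j _; ring.
Qed.

(* At a point where [h] is within [e] of a negative infimum, [laplacian h] is
   negative once [e] is small. *)
Lemma minimum_principle (J : {pred int}) (h : int -> R) (B : R) :
  (forall k, B <= h k) -> (forall k, k \in J -> 0 <= h k) ->
  (forall k, k \notin J -> 0 <= laplacian h k) -> forall k, 0 <= h k.
Proof.
move=> hB hJ hJ' k0; rewrite leNgt; apply/negP => hk0.
have hinf : has_inf (range h).
  by split; [exists (h k0), k0|exists B => _ [k _ <-]].
set m := inf (range h).
have mP k : m <= h k by apply: ge_inf; [exact: hinf.2|exists k].
have m_lt0 : m < 0 by apply: le_lt_trans hk0.
pose S := \sum_(1 <= j < n) c j.
have S_ge0 : 0 <= S.
  by rewrite /S big_nat sumr_ge0// => j /andP[j1 _]; exact: c_ge0.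
have S2 : 0 < lam + S + S by rewrite ltr_wpDr// ltr_wpDr.
(* Where [h k < m + e], each second difference is at most [2 * e], so [laplacian h k < lam * m + e *
   (lam + 2 * S)]; this [e] turns the bound into [lam * m / 2 < 0]. *)
pose e := lam * (- m) / (2 * (lam + S + S)).
have e_gt0 : 0 < e by rewrite divr_gt0 ?mulr_gt0 ?oppr_gt0.
have eE : e * (lam + S + S) = lam * (- m) / 2 by rewrite /e; field; lra.
have [_ [k _ <-] hk] := inf_adherent e_gt0 hinf; rewrite -/m in hk.
have e_small : e < - m.
  rewrite -(@ltr_pM2r _ (lam + S + S))// eE.
  have : 0 <= - m * (S + S) by rewrite mulr_ge0 ?addr_ge0 ?oppr_ge0 ?(ltW m_lt0).
  have : 0 < - m * lam by rewrite mulr_gt0 ?oppr_gt0.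
  lra.
have kJ : k \notin J.
  by apply/negP => /hJ; rewrite leNgt (lt_trans hk)//; lra.
have := hJ' _ kJ; apply/negP; rewrite -ltNge /laplacian.
have : \sum_(1 <= j < n) c j * (2 * h k - h (k + j%:Z) - h (k - j%:Z)) <=
    S * (2 * e).
  rewrite /S mulr_suml big_nat [leRHS]big_nat.
  apply: ler_sum => j /andP[j1 _].
  rewrite ler_wpM2l ?c_ge0//.
  by have := mP (k + j%:Z); have := mP (k - j%:Z); lra.
have : lam * h k < lam * (m + e) by rewrite ltr_pM2l.
have : 0 < lam * (- m) by rewrite mulr_gt0// oppr_gt0.
move: eE; rewrite !mulrDr !mulrDl mulrN; lra.
Qed.

(** Uniqueness for the bounded Dirichlet problem: the minimum principle applies to [h] and to
    [- h]. *)
Lemma laplacian_eq0 (J : {pred int}) (h : int -> R) (B : R) :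
  (forall k, `|h k| <= B) -> (forall k, k \in J -> h k = 0) ->
  (forall k, k \notin J -> laplacian h k = 0) -> forall k, h k = 0.
Proof.
move=> hB hJ hJ' k; apply/eqP; rewrite eq_le -[h k <= 0]oppr_ge0.
apply/andP; split.
- apply: (@minimum_principle J (fun k => - h k) (- B)) => [{}k|{}k kJ|{}k kJ].
  + by rewrite lerN2 (le_trans (ler_norm _)).
  + by rewrite hJ// oppr0.
  + by rewrite laplacianN hJ'// oppr0.
- apply: (@minimum_principle J h (- B)) => [{}k|{}k kJ|{}k kJ].
  + by rewrite lerNl (le_trans _ (hB k))// -normrN ler_norm.
  + by rewrite hJ.
  + by rewrite hJ'.
Qed.

(** * Bounded fundamental solutions and equilibrium measures of finite sets *)

Section green.
Context (G : int -> R) (B : R).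
Hypothesis G_bnd : forall k, `|G k| <= B.
Hypothesis lapG : forall k, laplacian G k = (k == 0)%:R.

Lemma fundamental_solution_ge0 k : 0 <= G k.
Proof.
apply: (@minimum_principle pred0 G (- B)) => [{}k|//|{}k _].
  by rewrite lerNl (le_trans _ (G_bnd k))// -normrN ler_norm.
by rewrite lapG ler0n.
Qed.

Lemma laplacian_shift k l : laplacian (fun k => G (k - l)) k = (k == l)%:R.
Proof.
rewrite -subr_eq0 -lapG /laplacian; congr (_ + _).
by apply: eq_bigr => j _; rewrite !(addrAC _ _ (- l)).
Qed.

Context (m : nat) (s : 'I_m -> int).
Hypothesis s_inj : injective s.

Let potential (p : 'I_m -> R) (k : int) := \sum_j p j * G (k - s j).

Let laplacian_potential p k :
  laplacian (potential p) k = \sum_j p j * (k == s j)%:R.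
Proof.
by rewrite laplacian_sum; apply: eq_bigr => j _; rewrite laplacian_shift.
Qed.

Let laplacian_potential_in p i : laplacian (potential p) (s i) = p i.
Proof.
rewrite laplacian_potential (bigD1 i)//= eqxx mulr1 big1 ?addr0// => j ji.
by rewrite (inj_eq s_inj) eq_sym (negPf ji) mulr0.
Qed.

Let laplacian_potential_out p k : k \notin codom s ->
  laplacian (potential p) k = 0.
Proof.
move=> ks; rewrite laplacian_potential big1// => j _.
by case: eqP => [kE|]; rewrite ?mulr0//; rewrite kE codom_f in ks.
Qed.

Let potential_bnd p k : `|potential p k| <= \sum_j `|p j| * B.
Proof.
apply: le_trans (ler_norm_sum _ _ _) _; apply: ler_sum => j _.
by rewrite normrM ler_wpM2l.
Qed.

(** The weights solve a linear system whose matrix is invertible by uniqueness for the Dirichlet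
    problem. They are recovered as the Laplacian of their potential, and that potential has its
    maximum 1 at the points [s i], so they are nonnegative. The last bound keeps only the diagonal
    term of the potential. *)
Lemma equilibrium_measure : exists p : 'I_m -> R,
  [/\ forall i, 0 <= p i, forall i, \sum_j p j * G (s i - s j) = 1 &
      forall i, p i * G 0 <= 1].
Proof.
pose A : 'M[R]_m := \matrix_(j, i) G (s i - s j).
(* A kernel vector has a potential that vanishes at the points and has zero Laplacian elsewhere; it
   is zero everywhere, and so is the vector. *)
have A_unit : A \in unitmx.
  rewrite unitmxE unitfE; apply/negP => /det0P[v /negP v0 vA]; apply: v0.
  apply/eqP/rowP => i; rewrite mxE -(laplacian_potential_in (v 0)).
  suff h0 k : potential (v 0) k = 0.
    by rewrite /laplacian h0 mulr0 add0r big1// => j _; rewrite !h0; ring.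
  apply: (laplacian_eq0 (mem (codom s)) (potential (v 0)) _ (potential_bnd (v 0))).
    move=> _ /codomP[l ->]; move/rowP: vA => /(_ l); rewrite !mxE => <-.
    by apply: eq_bigr => j _; rewrite mxE.
  by move=> {}k; exact: laplacian_potential_out.
pose v := const_mx 1 *m invmx A : 'rV_m.
have vE i : potential (v 0) (s i) = 1.
  have : (v *m A) 0 i = 1 by rewrite /v mulmxKV// mxE.
  by rewrite mxE => <-; apply: eq_bigr => j _; rewrite [A _ _]mxE.
have v_le1 k : 0 <= 1 - potential (v 0) k.
  apply: (minimum_principle (mem (codom s)) (fun k => 1 - potential (v 0) k)
    (1 - \sum_j `|v 0 j| * B)) => {k} [k|_ /codomP[i ->]|k ks].
  - by rewrite lerD2l lerN2 (le_trans (ler_norm _)).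
  - by rewrite vE subrr.
  - by rewrite laplacian_1B laplacian_potential_out// subr0 ltW.
(* At [s i] the potential equals its upper bound 1, so every second difference in the Laplacian is
   nonnegative. *)
have v_ge0 i : 0 <= v 0 i.
  rewrite -laplacian_potential_in /laplacian vE mulr1 addr_ge0 ?(ltW lam_gt0)//.
  rewrite big_nat sumr_ge0// => j /andP[j1 _]; rewrite mulr_ge0 ?c_ge0//.
  by have := v_le1 (s i + j%:Z); have := v_le1 (s i - j%:Z); lra.
exists (v 0); split=> // i; rewrite -(vE i) /potential (bigD1 i)//= subrr lerDl.
by apply: sumr_ge0 => j _; rewrite mulr_ge0 ?fundamental_solution_ge0.
Qed.

End green.
End minimum_principle.

(** The bound [K] is uniform over the approximating kernels, so the equilibrium measure of a close
    enough [G'] has [G]-potential within [d] of 1; dividing by [1 - d] puts that potential between 1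
    and [1 + e]. *)
Lemma approximate_equilibrium {R : realType} (G : int -> R) (K : R) m
    (s : 'I_m -> int) (e : R) : 0 < K -> 0 < e ->
  (forall d, 0 < d -> exists (G' : int -> R),
    (forall i j, `|G (s i - s j) - G' (s i - s j)| <= d) /\
    exists p : 'I_m -> R,
      [/\ forall i, 0 <= p i, forall i, \sum_j p j * G' (s i - s j) = 1 &
          forall i, p i <= K]) ->
  exists p : 'I_m -> R, (forall i, 0 <= p i) /\
    forall i, 1 <= \sum_j p j * G (s i - s j) <= 1 + e.
Proof.
(* This [d] solves [(1 + d) / (1 - d) = 1 + e]. *)
move=> K0 e0 approx; pose d := e / (2 + e).
have d0 : 0 < d by rewrite divr_gt0//; lra.
have d1 : 0 < 1 - d.
  by rewrite /d -(ltr_pM2r (_ : 0 < 2 + e)); [rewrite mulrBl divfK|]; lra.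
pose m1 : R := m%:R + 1.
have m1_gt0 : 0 < m1 by rewrite /m1 ltr_wpDl.
(* At most [m] errors, each [K] times this accuracy, add up to at most [d]; [m1 = m + 1] stays
   positive for [m = 0]. *)
have [|G' [GG' [p [p0 pE pK]]]] := approx (d / (m1 * K)).
  by rewrite divr_gt0// mulr_gt0.
have near1 i : `|\sum_j p j * G (s i - s j) - 1| <= d.
  rewrite -(pE i) -sumrB.
  apply: le_trans (ler_norm_sum _ _ _) _.
  apply: (@le_trans _ _ (\sum_(j < m) d / m1)).
    apply: ler_sum => j _; rewrite -mulrBr normrM ger0_norm//.
    apply: le_trans (ler_pM _ _ (pK j) (GG' i j)) _ => //.
    by rewrite le_eqVlt; apply/orP; left; apply/eqP; field; lra.
  rewrite sumr_const card_ord -[_ *+ _]mulr_natr mulrAC ler_pdivrMr//.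
  by rewrite ler_wpM2l ?(ltW d0)// /m1 lerDl.
exists (fun i => p i / (1 - d)); split=> [i|i]; first by rewrite divr_ge0// ltW.
under eq_bigr do rewrite mulrAC.
rewrite -mulr_suml ler_pdivlMr// ler_pdivrMr//.
have := near1 i; rewrite ler_norml => /andP[lo hi].
have -> : (1 + e) * (1 - d) = 1 + d by rewrite /d; field; lra.
lra.
Qed.

(** * The strong capacitary inequality *)

Section layer_cake.
Context {R : realType}.
Implicit Types (a b nu : nat -> R) (m : nat).

(** The value 0 before the first index makes [a i - before a i] the thickness of the [i]-th layer,
    the lowest layer starting at height 0. *)
Definition before a (i : nat) : R := if i is j.+1 then a j else 0.

Lemma sum_increments a m : \sum_(i < m) (a i - before a i) = before a m.
Proof.
elim: m => [|m IH]; first by rewrite big_ord0.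
by rewrite big_ord_recr/= IH; ring.
Qed.

(** Abel summation. When [a] is nondecreasing, the inner sums are the [nu]-masses of its superlevel
    sets. *)
Lemma layer_cake a nu m :
  \sum_(i < m) a i * nu i =
  \sum_(i < m) (a i - before a i) * \sum_(j < m | (i <= j)%N) nu j.
Proof.
elim: m => [|m IH]; first by rewrite !big_ord0.
have eqS i : (i <= m)%N ->
    \sum_(j < m.+1 | (i <= j)%N) nu j = \sum_(j < m | (i <= j)%N) nu j + nu m.
  by move=> im; rewrite big_mkcond big_ord_recr/= im -big_mkcond.
rewrite [LHS]big_ord_recr [RHS]big_ord_recr/= IH eqS//.
rewrite [X in _ = X + _](eq_bigr (fun i : 'I_m =>
  (a i - before a i) * \sum_(j < m | (i <= j)%N) nu j +
  (a i - before a i) * nu m)); last first.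
  by move=> i _ /=; rewrite eqS ?mulrDr// ltnW.
rewrite big_split/= -mulr_suml sum_increments.
rewrite [X in _ * (X + _)]big_pred0 => [|i]; first by ring.
by apply/negbTE; rewrite -ltnNge ltn_ord.
Qed.

(** Discrete form of bounding a symmetric double integral by twice its part below the diagonal. For
    fixed [i] the increments of smaller index sum to [before a i], and with [d = a i - before a i]
    one has [2 * before a i * d + d ^+ 2 = a i ^+ 2 - before a i ^+ 2]. *)
Lemma sum_increments_quad a b (q : nat -> nat -> R) m :
  (forall i, (i < m)%N -> before a i <= a i) ->
  (forall i j, q i j = q j i) ->
  (forall i j, (j <= i < m)%N -> q i j <= b i) ->
  \sum_(i < m) \sum_(j < m)
    (a i - before a i) * (a j - before a j) * q i j <=
  \sum_(i < m) (a i ^+ 2 - before a i ^+ 2) * b i.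
Proof.
move=> + qC; elim: m => [|m IH] a_incr qb; first by rewrite !big_ord0.
have {}IH : \sum_(i < m) \sum_(j < m)
      (a i - before a i) * (a j - before a j) * q i j <=
    \sum_(i < m) (a i ^+ 2 - before a i ^+ 2) * b i.
  apply: IH => [i im|i j /andP[ji im]]; first by apply: a_incr; apply: ltnW.
  by apply: qb; rewrite ji/= ltnS ltnW.
have d_ge0 i : (i <= m)%N -> 0 <= a i - before a i.
  by move=> im; rewrite subr_ge0 a_incr.
rewrite big_ord_recr/= [X in X + _ <= _](_ : _ = \sum_(i < m) \sum_(j < m)
    (a i - before a i) * (a j - before a j) * q i j +
   \sum_(i < m) (a i - before a i) * (a m - before a m) * q m i); last first.
  by rewrite -big_split; apply: eq_bigr => i _; rewrite big_ord_recr/= [q m i]qC.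
have cross : \sum_(i < m) (a i - before a i) * (a m - before a m) * q m i <=
    before a m * (a m - before a m) * b m.
  rewrite -[X in X * _ * _]sum_increments !mulr_suml; apply: ler_sum => i _.
  have im : (i <= m)%N := ltnW (ltn_ord i).
  by apply: ler_wpM2l; [rewrite mulr_ge0 ?d_ge0|rewrite qb// im/=].
rewrite !big_ord_recr/= [X in _ + (X + _) <= _](_ : _ =
  \sum_(i < m) (a i - before a i) * (a m - before a m) * q m i); last first.
  by apply: eq_bigr => i _; ring.
have diag : (a m - before a m) * (a m - before a m) * q m m <=
    (a m - before a m) * (a m - before a m) * b m.
  by apply: ler_wpM2l; [rewrite mulr_ge0 ?d_ge0|rewrite qb// leqnn ltnSn].
set Q := \sum_(i < m) _ in IH *; set P := \sum_(i < m) _ in cross *.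
set B := \sum_(i < m) _ in IH *.
have -> : (a m ^+ 2 - before a m ^+ 2) * b m =
  before a m * (a m - before a m) * b m + before a m * (a m - before a m) * b m
  + (a m - before a m) * (a m - before a m) * b m by ring.
lra.
Qed.

Lemma sum_bilinear m (d x y : nat -> R) (p : nat -> nat -> R)
    (G : nat -> nat -> R) :
  \sum_(j < m) \sum_(k < m)
    (\sum_(i < m) d i * p i j) * (\sum_(i < m) d i * p i k) * G j k =
  \sum_(i < m) \sum_(l < m) d i * d l *
    \sum_(j < m) \sum_(k < m) p i j * p l k * G j k.
Proof.
transitivity (\sum_(j < m) \sum_(k < m) \sum_(i < m) \sum_(l < m)
    d i * d l * (p i j * p l k * G j k)).
  apply: eq_bigr => j _; apply: eq_bigr => k _.
  rewrite mulr_suml mulr_suml; apply: eq_bigr => i _.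
  rewrite mulr_sumr mulr_suml; apply: eq_bigr => l _; ring.
transitivity (\sum_(j < m) \sum_(i < m) \sum_(l < m) \sum_(k < m)
    d i * d l * (p i j * p l k * G j k)).
  apply: eq_bigr => j _; rewrite exchange_big/=; apply: eq_bigr => i _.
  by rewrite exchange_big.
rewrite exchange_big/=; apply: eq_bigr => i _.
rewrite exchange_big/=; apply: eq_bigr => l _.
by rewrite mulr_sumr; apply: eq_bigr => j _; rewrite mulr_sumr.
Qed.

(* [p i] plays the role of the equilibrium measure of the superlevel set
   [{j | i <= j}] of the nondecreasing function [a], and [N] that of the
   squared norm of [a]; [normP] is the Cauchy-Schwarz inequality between
   energy and squared norm, in the form given by AM-GM. *)
Lemma strong_capacitary_inequality m a nu (G p : nat -> nat -> R) (e C N : R) :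
  0 <= e -> 0 <= C ->
  (forall i, (i < m)%N -> 0 <= before a i <= a i) ->
  (forall i j, (i <= j < m)%N -> a i <= a j) ->
  (forall i j, G i j = G j i) ->
  (forall i j, 0 <= p i j) ->
  (forall i j, (j < i)%N -> p i j = 0) ->
  (forall i j, (i <= j < m)%N -> \sum_(k < m) p i k * G j k <= 1 + e) ->
  (forall (M : nat -> R) (th : R), (forall j, 0 <= M j) -> 0 < th ->
    2 * \sum_(j < m) M j * a j <=
      th * N + th^-1 * \sum_(j < m) \sum_(k < m) M j * M k * G j k) ->
  (forall i, (i < m)%N -> \sum_(j < m | (i <= j)%N) nu j <=
    C * \sum_(j < m) \sum_(k < m) p i j * p i k * G j k) ->
  \sum_(i < m) a i ^+ 2 * nu i <= 4 * C * (1 + e) ^+ 2 * N.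
Proof.
move=> e_ge0 C_ge0 a_incr a_mono GC p_ge0 p_supp pot normP nuP.
pose d i := a i - before a i.
have d_ge0 i : (i < m)%N -> 0 <= d i.
  by move=> im; rewrite subr_ge0; case/andP: (a_incr i im).
pose mass i := \sum_(j < m) p i j.
have mass_ge0 i : 0 <= mass i by apply: sumr_ge0.
pose q i l := \sum_(j < m) \sum_(k < m) p i j * p l k * G j k.
have qC i l : q i l = q l i.
  rewrite /q exchange_big/=; apply: eq_bigr => j _; apply: eq_bigr => k _.
  by rewrite GC; ring.
(* The nesting of level sets enters here: [p i] lives on indices at least [i], hence at least [l],
   where the potential of [p l] is at most [1 + e]. *)
have q_mass i l : (l <= i < m)%N -> q i l <= (1 + e) * mass i.
  move=> /andP[li im]; rewrite mulr_sumr; apply: ler_sum => j _.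
  have [ji|ij] := ltnP j i.
    by rewrite p_supp// mulr0 big1// => k _; rewrite !mul0r.
  rewrite (eq_bigr (fun k : 'I_m => p i j * (p l k * G j k))); last first.
    by move=> k _; ring.
  by rewrite -mulr_sumr mulrC ler_wpM2r// pot// (leq_trans li ij) ltn_ord.
pose A := \sum_(i < m) (a i ^+ 2 - before a i ^+ 2) * mass i.
pose M j := \sum_(i < m) d i * p i j.
have M_ge0 j : 0 <= M j by apply: sumr_ge0 => i _; rewrite mulr_ge0 ?d_ge0.
(* Here [a i ^+ 2 - before a i ^+ 2 <= 2 * d i * a i], and [a j >= a i] wherever [p i] is
   carried. *)
have A_le : A <= 2 * \sum_(j < m) M j * a j.
  rewrite (_ : \sum_(j < m) M j * a j =
      \sum_(i < m) d i * \sum_(j < m) p i j * a j); last first.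
    under eq_bigr do rewrite mulr_suml.
    rewrite exchange_big/=; apply: eq_bigr => i _; rewrite mulr_sumr.
    by apply: eq_bigr => j _; rewrite mulrA.
  rewrite mulr_sumr; apply: ler_sum => i _.
  have low : a i * mass i <= \sum_(j < m) p i j * a j.
    rewrite mulr_sumr; apply: ler_sum => j _.
    have [ji|ij] := ltnP j i; first by rewrite p_supp// mulr0 mul0r.
    by rewrite mulrC ler_wpM2l// a_mono// ij ltn_ord.
  have := ler_wpM2l (d_ge0 i (ltn_ord i)) low.
  have /andP[b0 ba] := a_incr i (ltn_ord i).
  have : d i * (before a i * mass i) <= d i * (a i * mass i).
    by rewrite ler_wpM2l ?d_ge0// ler_wpM2r.
  rewrite (_ : (a i ^+ 2 - _) * _ =
    d i * (a i * mass i) + d i * (before a i * mass i)); last by rewrite /d; ring.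
  lra.
have energy_le : \sum_(j < m) \sum_(k < m) M j * M k * G j k <= (1 + e) * A.
  rewrite sum_bilinear//.
  apply: le_trans
    (@sum_increments_quad a (fun i => (1 + e) * mass i) q m _ _ _) _ => //.
    by move=> i im; case/andP: (a_incr i im).
  by rewrite mulr_sumr ler_sum// => i _; rewrite mulrCA.
have e1_gt0 : 0 < 1 + e by lra.
have A_le4 : A <= 4 * (1 + e) * N.
  (* With [th = 2 * (1 + e)] the energy term is at most [A / 2] and is absorbed by the left side. *)
  have th_gt0 : 0 < 2 * (1 + e) by lra.
  have := normP M (2 * (1 + e)) M_ge0 th_gt0.
  have : (2 * (1 + e))^-1 * \sum_(j < m) \sum_(k < m) M j * M k * G j k <= A / 2.
    apply: le_trans (ler_wpM2l _ energy_le) _; first by rewrite invr_ge0 ltW.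
    by rewrite le_eqVlt; apply/orP; left; apply/eqP; field; lra.
  lra.
rewrite (layer_cake (fun i => a i ^+ 2)).
have beforeX i : before (fun i => a i ^+ 2) i = before a i ^+ 2.
  by case: i => //=; rewrite expr0n.
(* The energy of [p i] is at most [(1 + e) * mass i], so summing the capacity bound over the layers
   gives [C * (1 + e) * A]. *)
apply: (@le_trans _ _ (C * (1 + e) * A)); last first.
  apply: le_trans (ler_wpM2l _ A_le4) _; first by rewrite mulr_ge0// ltW.
  by rewrite le_eqVlt; apply/orP; left; apply/eqP; ring.
rewrite mulr_sumr; apply: ler_sum => i _.
have /andP[b0 ba] := a_incr i (ltn_ord i).
rewrite beforeX mulrCA ler_wpM2l//.
  by rewrite subr_ge0 lerXn2r ?nnegrE// (le_trans b0).
apply: le_trans (nuP i (ltn_ord i)) _.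
by rewrite -mulrA ler_wpM2l// q_mass// leqnn ltn_ord.
Qed.

End layer_cake.

(** * Reciprocals of trigonometric polynomials *)

Section trigonometric_weight.
Context {R : realType}.

Definition trig_weight (lam : R) (c : nat -> R) (n : nat) (t : R) : R :=
  lam + 4 * \sum_(1 <= k < n) c k * sin (k%:R * t / 2) ^+ 2.

Lemma sin2_half (x : R) : 4 * sin (x / 2) ^+ 2 = 2 - 2 * cos x.
Proof.
rewrite {2}[x](_ : _ = x / 2 + x / 2); last by field.
by rewrite cosD -!expr2 cos2sin2; ring.
Qed.

Context (lam : R) (c : nat -> R) (n : nat).
Hypothesis lam_gt0 : 0 < lam.
Hypothesis c_ge0 : forall k, (1 <= k)%N -> 0 <= c k.
Notation v := (trig_weight lam c n).

Lemma trig_weight_ge t : lam <= v t.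
Proof.
rewrite lerDl mulr_ge0// big_nat sumr_ge0// => j /andP[j1 _].
by rewrite mulr_ge0 ?c_ge0 ?sqr_ge0.
Qed.

Lemma trig_weight_gt0 t : 0 < v t.
Proof. exact: lt_le_trans (trig_weight_ge t). Qed.

Lemma measurable_trig_weight : measurable_fun setT v.
Proof.
apply: measurable_funD; first exact: measurable_cst.
apply: measurable_funM; first exact: measurable_cst.
apply: measurable_sum => k.
apply: measurable_funM; first exact: measurable_cst.
under eq_fun do rewrite mulrAC.
apply: measurable_funX; apply: continuous_measurable_fun;
  exact: continuous_sinM.
Qed.

Lemma measurable_trig_weightV : measurable_fun setT (fun t => (v t)^-1).
Proof.
rewrite (_ : (fun t => _) = (fun x : R => x `^ (-1)) \o v).
  by apply: measurableT_comp; [exact: measurable_powR|exact: measurable_trig_weight].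
by apply/funext => t /=; rewrite powR_inv1// ltW ?trig_weight_gt0.
Qed.

Context (phi : R -> R).
Hypothesis phi_le1 : forall x, `|phi x| <= 1.
Hypothesis phi_cont : forall r : R, continuous (fun t : R => phi (r * t)).
Hypothesis phi_prod : forall x y, phi (x + y) + phi (x - y) = 2 * phi x * cos y.

Let F (k : int) t := phi (k%:~R * t) / v t.

Let F_le k t : `|F k t| <= lam^-1.
Proof.
rewrite normrM normfV [`|v t|]ger0_norm ?(ltW (trig_weight_gt0 t))//.
rewrite -[leRHS]mul1r ler_pM ?invr_ge0 ?(ltW (trig_weight_gt0 t))//.
by rewrite lef_pV2 ?posrE ?trig_weight_gt0// trig_weight_ge.
Qed.

Let F_int k : circle_integrable (F k).
Proof.
apply: (@circle_integrable_bounded _ _ lam^-1 _ (F_le k)).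
apply/measurable_funTS/measurable_funM; last exact: measurable_trig_weightV.
apply: continuous_measurable_fun; exact: phi_cont.
Qed.

Lemma mean_div_trig_weight_le k :
  `|mean (fun t => phi (k%:~R * t) / v t)| <= lam^-1.
Proof. exact: (mean_normr_le _ _ (F_int k) (F_le k)). Qed.

(** Here [phi] stands for [cos] or [sin]. By their common product formula, the Laplacian in [k]
    multiplies the integrand by its symbol [v], which cancels the division. *)
Lemma laplacian_mean k :
  laplacian lam c n (fun k => mean (fun t => phi (k%:~R * t) / v t)) k =
  mean (fun t => phi (k%:~R * t)).
Proof.
have -> : (fun t => phi (k%:~R * t)) = fun t => lam * F k t +
    \sum_(1 <= j < n) c j * (2 * F k t - F (k + j%:Z) t - F (k - j%:Z) t).
  apply/funext => t.
  have vt : v t != 0 by rewrite gt_eqF ?trig_weight_gt0.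
  transitivity (v t * F k t); first by rewrite /F mulrCA divff ?mulr1.
  rewrite {1}/trig_weight mulrDl -mulrA; congr (_ + _).
  rewrite mulr_suml mulr_sumr; apply: eq_bigr => j _.
  transitivity (c j * (4 * sin (j%:R * t / 2) ^+ 2) * F k t); first by ring.
  rewrite sin2_half -mulrA; congr (_ * _).
  rewrite /F intrD intrB [in RHS](mulrDl _ _ t) [in RHS](mulrBl t).
  have -> : (2 - 2 * cos (j%:R * t)) * (phi (k%:~R * t) / v t) =
    (2 * phi (k%:~R * t) - 2 * phi (k%:~R * t) * cos (j%:R * t)) / v t by ring.
  by rewrite -phi_prod; ring.
have D_int (j : nat) :
    circle_integrable (fun t => 2 * F k t - F (k + j%:Z) t - F (k - j%:Z) t).
  by do 2 ?apply: circle_integrableB => //; exact: circle_integrableZ.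
rewrite meanD ?meanZ//; last 2 first.
- exact: circle_integrableZ.
- by apply: circle_integrable_sum => j; exact: circle_integrableZ.
rewrite mean_sum => [|j]; last exact: circle_integrableZ.
rewrite /laplacian; congr (_ + _); apply: eq_bigr => j _.
rewrite meanZ//; congr (_ * _).
rewrite meanB ?meanB ?meanZ//; first exact: circle_integrableZ.
by apply: circle_integrableB => //; exact: circle_integrableZ.
Qed.

End trigonometric_weight.

(** * Green functions of positive trigonometric polynomials *)

Section green_trig_weight.
Context {R : realType} (lam : R) (c : nat -> R) (n : nat).
Hypothesis lam_gt0 : 0 < lam.
Hypothesis c_ge0 : forall k, (1 <= k)%N -> 0 <= c k.
Notation v := (trig_weight lam c n).

Lemma normr_cos_le1 (x : R) : `|cos x| <= 1.
Proof. by rewrite ler_norml cos_geN1 cos_le1. Qed.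

Lemma normr_sin_le1 (x : R) : `|sin x| <= 1.
Proof. by rewrite ler_norml sin_geN1 sin_le1. Qed.

Lemma cos_prod (x y : R) : cos (x + y) + cos (x - y) = 2 * cos x * cos y.
Proof. by rewrite cosD cosB; ring. Qed.

Lemma sin_prod (x y : R) : sin (x + y) + sin (x - y) = 2 * sin x * cos y.
Proof. by rewrite sinD sinB; ring. Qed.

(* The sine coefficients are a bounded solution of [laplacian h = 0]. *)
Lemma mean_sin_div_trig_weight k : mean (fun t => sin (k%:~R * t) / v t) = 0.
Proof.
apply: (@laplacian_eq0 _ lam c n lam_gt0 c_ge0 pred0
  (fun k => mean (fun t => sin (k%:~R * t) / v t)) lam^-1) => // {}k.
  by apply: mean_div_trig_weight_le => //;
    [exact: normr_sin_le1|exact: continuous_sinM].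
move=> _; rewrite (@laplacian_mean _ _ _ _ _ _ sin) ?mean_sin//;
  [exact: normr_sin_le1|exact: continuous_sinM|exact: sin_prod].
Qed.

(** The cosine coefficients form a bounded fundamental solution of the Laplacian. *)
Lemma mean_cos_div_trig_weight_ge0 k :
  0 <= mean (fun t => cos (k%:~R * t) / v t).
Proof.
apply: (@fundamental_solution_ge0 _ lam c n lam_gt0 c_ge0
  (fun k => mean (fun t => cos (k%:~R * t) / v t)) lam^-1) => {}k.
  by apply: mean_div_trig_weight_le => //;
    [exact: normr_cos_le1|exact: continuous_cosM].
rewrite (@laplacian_mean _ _ _ _ _ _ cos) ?mean_cos//;
  [exact: normr_cos_le1|exact: continuous_cosM|exact: cos_prod].
Qed.

(** The bound on [p i] comes from [p i * G 0 <= 1] and [G 0 >= K^-1], as [G 0] is the mean of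
    [1 / v]. It depends on [v] only through an upper bound, so it survives the passage to the limit
    weight. *)
Lemma trig_weight_equilibrium m (s : 'I_m -> int) (K : R) : injective s ->
  (forall t, v t <= K) ->
  exists p : 'I_m -> R, [/\ forall i, 0 <= p i,
    forall i, \sum_j p j * mean (fun t => cos ((s i - s j)%:~R * t) / v t) = 1 &
    forall i, p i <= K].
Proof.
move=> s_inj vK.
have K_gt0 : 0 < K by apply: lt_le_trans (vK 0); exact: trig_weight_gt0.
pose G (k : int) := mean (fun t => cos (k%:~R * t) / v t).
have G_le k : `|G k| <= lam^-1.
  by apply: mean_div_trig_weight_le => //;
    [exact: normr_cos_le1|exact: continuous_cosM].
have lapG k : laplacian lam c n G k = (k == 0)%:R.
  rewrite (@laplacian_mean _ _ _ _ _ _ cos) ?mean_cos//;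
    [exact: normr_cos_le1|exact: continuous_cosM|exact: cos_prod].
have [p [p_ge0 pG p0]] :=
  equilibrium_measure _ _ _ lam_gt0 c_ge0 _ _ G_le lapG _ s s_inj.
exists p; split=> // i; apply: le_trans (_ : p i * G 0 * K <= _); last first.
  by rewrite -[leRHS]mul1r ler_wpM2r// ltW.
rewrite -mulrA ler_peMr// -ler_pdivrMr// div1r.
rewrite -[K^-1]mean_cst; apply: mean_le.
- apply: (@circle_integrable_bounded _ _ `|K^-1|) => //; exact: measurable_cst.
- apply: (@circle_integrable_bounded _ _ lam^-1).
    apply/measurable_funTS/measurable_funM; last exact: measurable_trig_weightV.
    apply: continuous_measurable_fun; exact: continuous_cosM.
  move=> t; rewrite mul0r cos0 mul1r normfV.
  rewrite ger0_norm ?(ltW (trig_weight_gt0 _ _ _ _ _ _))//.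
  by rewrite lef_pV2 ?posrE ?trig_weight_gt0// trig_weight_ge.
- by move=> t /=; rewrite mul0r cos0 mul1r lef_pV2 ?posrE ?trig_weight_gt0.
Qed.

End green_trig_weight.

(** * The Green function *)

Section weight.
Context {R : realType} (c : nat -> R).
Hypothesis c_ge0 : forall k, (1 <= k)%N -> 0 <= c k.
Hypothesis c_sum_fin : (\sum_(1 <= k <oo) (c k)%:E < +oo)%E.
Notation mu := lebesgue_measure.
Notation w := (weight c).
Notation g := (fun t => (weight c t)^-1).

Let S n := \sum_(1 <= k < n) c k.
Let W t n := \sum_(1 <= k < n) c k * sin (k%:R * t / 2) ^+ 2.

Lemma partial_sum_diff (u : nat -> R) n m : (n <= m)%N ->
  (forall k, (1 <= k)%N -> 0 <= u k) ->
  0 <= \sum_(1 <= k < m) u k - \sum_(1 <= k < n) u k.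
Proof.
(* The sums start at index 1, so the empty sum for [n = 0] is treated apart before splitting at
   [n]. *)
move=> + u_ge0; case: n => [_|n nm].
  by rewrite [X in _ - X]big_geq// subr0 big_nat sumr_ge0// => k /andP[/u_ge0].
rewrite (big_cat_nat _ _ (n := n.+1))//= addrAC subrr add0r big_nat.
by rewrite sumr_ge0// => k /andP[nk _]; rewrite u_ge0// (leq_trans _ nk).
Qed.

Let total : R := fine (\sum_(1 <= k <oo) (c k)%:E)%E.

Let S_le n : S n <= total.
Proof.
have c0 k : (1 <= k)%N -> true -> (0 <= (c k)%:E)%E.
  by move=> k1 _; rewrite lee_fin c_ge0.
have fin : (\sum_(1 <= k <oo) (c k)%:E)%E \is a fin_num.
  by rewrite ge0_fin_numE//; apply: nneseries_ge0.
rewrite -lee_fin /total fineK// -sumEFin.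
exact: (nneseries_lim_ge n c0).
Qed.

Let S_cvg : cvgn S.
Proof.
apply: nondecreasing_is_cvgn => [n m nm|].
  by rewrite -subr_ge0; exact: partial_sum_diff.
by exists total => _ [n _ <-].
Qed.

Let S_lim n : S n <= limn S.
Proof.
by apply: nondecreasing_cvgn_le => // i j ij; rewrite -subr_ge0 partial_sum_diff.
Qed.

Let term_ge0 t k : (1 <= k)%N -> 0 <= c k * sin (k%:R * t / 2) ^+ 2.
Proof. by move=> k1; rewrite mulr_ge0 ?c_ge0 ?sqr_ge0. Qed.

Let W_homo t : {homo W t : n m / (n <= m)%N >-> n <= m}.
Proof.
by move=> n m nm; rewrite -subr_ge0 partial_sum_diff// => k; exact: term_ge0.
Qed.

(** The terms of [S - W t] are [c k] times a squared cosine, so this difference is nondecreasing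
    too; tails of [W t] are thus bounded uniformly in [t]. *)
Let W_diff t n m : (n <= m)%N -> W t m - W t n <= S m - S n.
Proof.
move=> nm; rewrite -subr_ge0.
have -> : S m - S n - (W t m - W t n) = (S m - W t m) - (S n - W t n) by ring.
rewrite /S /W -!sumrB; apply: partial_sum_diff => // k k1.
by rewrite -{1}[c k]mulr1 -mulrBr mulr_ge0 ?c_ge0// -cos2sin2 sqr_ge0.
Qed.

Let W_cvg t : cvgn (W t).
Proof.
apply: nondecreasing_is_cvgn; first exact: W_homo.
exists total => _ [n _ <-]; apply: le_trans (S_le n).
have := W_diff t 0 n (leq0n n).
by rewrite /W /S [in X in _ - X <= _]big_geq// [in X in _ <= _ - X]big_geq// !subr0.
Qed.

Lemma weight_ge0 t : 0 <= w t.
Proof.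
rewrite mulr_ge0// limr_ge//; first exact: W_cvg.
by apply: nearW => n; rewrite big_nat sumr_ge0// => k /andP[k1 _]; exact: term_ge0.
Qed.

(* Bounding the tail of the series crudely, [approx_weight n] majorizes [w],
   so that the reciprocals are dominated by [1 / w]. *)
Definition approx_weight (n : nat) : R -> R :=
  trig_weight (4 * (limn S - S n) + n.+1%:R^-1) c n.

(** The harmonic term keeps the offset positive even when the tail of [c] vanishes. *)
Lemma approx_weight_offset_gt0 n : 0 < 4 * (limn S - S n) + n.+1%:R^-1.
Proof. by rewrite ltr_wpDl ?invr_gt0 ?ltr0n// mulr_ge0// subr_ge0 S_lim. Qed.

Lemma approx_weight_gt0 n t : 0 < approx_weight n t.
Proof. exact: trig_weight_gt0 (approx_weight_offset_gt0 n) c_ge0 t. Qed.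

Lemma weight_le_approx n t : w t <= approx_weight n t.
Proof.
have : limn (W t) <= W t n + (limn S - S n).
  apply: limr_le; first exact: W_cvg.
  exists n => // m /= nm.
  by rewrite -lerBlDl (le_trans (W_diff t n m nm))// lerD2r S_lim.
have : 0 <= n.+1%:R^-1 :> R by rewrite invr_ge0.
rewrite /approx_weight /trig_weight /weight -/(W t n) -/(W t).
by move: (W t n) (S n) (limn S) (limn (W t)) n.+1%:R^-1 => x1 x2 x3 x4 x5; lra.
Qed.

Lemma approx_weight_le n t : approx_weight n t <= 4 * limn S + 1.
Proof.
have : W t n <= S n.
  have := W_diff t 0 n (leq0n n).
  by rewrite /W /S [in X in _ - X <= _]big_geq// [in X in _ <= _ - X]big_geq// !subr0.
have : n.+1%:R^-1 <= 1 :> R by rewrite invf_le1 ?ltr0n// ler1n.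
rewrite /approx_weight /trig_weight -/(W t n).
by move: (W t n) (S n) (limn S) n.+1%:R^-1 => x1 x2 x3 x4; lra.
Qed.

Lemma approx_weight_cvg t : approx_weight n t @[n --> \oo] --> w t.
Proof.
rewrite /approx_weight /trig_weight /weight -/(W t).
rewrite -[X in _ --> X]add0r; apply: cvgD; last first.
  by apply: cvgMr; exact: W_cvg.
rewrite -[X in _ --> X]addr0; apply: cvgD; last exact: cvg_harmonic.
rewrite -[X in _ --> X](mulr0 4); apply: cvgMr.
by rewrite -[X in _ --> X](subrr (limn S)); apply: cvgB => //; exact: cvg_cst.
Qed.

Lemma measurable_weight : measurable_fun circle w.
Proof.
apply: (@measurable_fun_cvg _ _ _ _ approx_weight) => [n|t _].
  by apply: measurable_funTS; exact: measurable_trig_weight.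
exact: approx_weight_cvg.
Qed.

Hypothesis w_inv : inv_integrable w.

(** The two inverses differ only where [w t = 0]: the real one is 0, the extended one [+oo]. *)
Lemma invw_le_inve t : ((g t)%:E <= (w t)%:E^-1)%E.
Proof. by rewrite inver; case: eqP => [->|_]; rewrite ?leey. Qed.

Lemma invw_ge0 t : 0 <= g t.
Proof. by rewrite invr_ge0 weight_ge0. Qed.

Lemma weight_neq0_ae : \forall t \ae mu, circle t -> w t != 0.
Proof.
have : \forall t \ae mu, circle t -> ((w t)%:E^-1)%E \is a fin_num.
  by apply: integrable_ae w_inv; exact: measurable_circle.
apply: (@filterS _ _ (ae_filter_ringOfSetsType mu)) => t /[apply].
by rewrite inver; case: eqP.
Qed.

Lemma measurable_invw : measurable_fun circle g.
Proof.
have [mw _] := integrableP _ _ _ w_inv.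
rewrite (_ : g = fine \o (fun t => (w t)%:E^-1)%E); last first.
  by apply/funext => t /=; rewrite fine_invr.
by apply: measurableT_comp mw; exact: fine_measurable.
Qed.

Lemma circle_integrable_invwM (u : R -> R) : measurable_fun circle u ->
  (exists B, forall t, `|u t| <= B) -> circle_integrable (fun t => u t * g t).
Proof.
move=> mu_ [B uB].
have iB : mu.-integrable circle (fun t => (B%:E * (w t)%:E^-1)%E).
  by apply: integrableZl w_inv; exact: measurable_circle.
apply: le_integrable iB.
- exact: measurable_circle.
- by apply/measurable_EFinP; apply: measurable_funM => //; exact: measurable_invw.
- move=> t _ /=; have B0 : 0 <= B by apply: le_trans (uB t).
  rewrite normrM [`|g t|]ger0_norm ?invw_ge0// gee0_abs; last first.
    by rewrite mule_ge0 ?lee_fin// inve_ge0 lee_fin weight_ge0.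
  rewrite EFinM; apply: lee_pmul; rewrite ?lee_fin ?invw_ge0//.
  exact: invw_le_inve.
Qed.

(** Dominated convergence with majorant [1 / w], since [approx_weight n >= w]; pointwise convergence
    holds off the null set where [w] vanishes. *)
Lemma mean_div_approx_weight_cvg (phi : R -> R) : measurable_fun circle phi ->
  (forall t, `|phi t| <= 1) ->
  mean (fun t => phi t / approx_weight n t) @[n --> \oo] -->
  mean (fun t => phi t / w t).
Proof.
move=> mphi phi_le1.
have mV n : measurable_fun circle (fun t => (approx_weight n t)^-1).
  by apply: measurable_funTS; apply: measurable_trig_weightV => //;
    exact: approx_weight_offset_gt0.
apply: cvgMr; apply: fine_cvg; rewrite fineK; last first.
  apply: integrable_fin_num; first exact: measurable_circle.
  by apply: circle_integrable_invwM => //; exists 1.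
suff [] : [/\ mu.-integrable circle (fun t => (phi t / w t)%:E),
  [sequence (\int[mu]_(t in circle)
     `|(phi t / approx_weight n t)%:E - (phi t / w t)%:E|)%E]_n @ \oo --> 0%E &
  [sequence (\int[mu]_(t in circle) (phi t / approx_weight n t)%:E)%E]_n @ \oo
     --> (\int[mu]_(t in circle) (phi t / w t)%:E)%E] by [].
apply: dominated_convergence w_inv _.
- exact: measurable_circle.
- move=> n; apply/measurable_EFinP; apply: measurable_funM => //; exact: mV.
- apply/measurable_EFinP; apply: measurable_funM => //; exact: measurable_invw.
- apply: (@filterS _ _ (ae_filter_ringOfSetsType mu)) weight_neq0_ae => t /[apply] wt.
  apply: cvg_EFin; first exact: nearW.
  by apply: cvgMr; apply: cvgV => //; exact: approx_weight_cvg.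
- apply: aeW => t n _.
  change (`|phi t / approx_weight n t|%:E <= (w t)%:E^-1)%E.
  rewrite normrM normfV [`|approx_weight n t|]ger0_norm; last first.
    by rewrite ltW ?approx_weight_gt0.
  apply: le_trans (_ : ((approx_weight n t)^-1%:E <= _)%E).
    by rewrite lee_fin ler_piMl// invr_ge0 ltW ?approx_weight_gt0.
  rewrite inver; case: eqP => [_|/eqP w0]; first exact: leey.
  rewrite lee_fin lef_pV2 ?posrE ?approx_weight_gt0 ?weight_le_approx//.
  by rewrite lt_neqAle eq_sym w0 weight_ge0.
Qed.

(** The full [k]-th Fourier coefficient of [1 / w]: its sine part is zero by [mean_sin_invw]. *)
Definition green (k : int) : R := mean (fun t => cos (k%:~R * t) * g t).

Lemma mean_sin_invw k : mean (fun t => sin (k%:~R * t) * g t) = 0.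
Proof.
have := mean_div_approx_weight_cvg (fun t => sin (k%:~R * t)).
move=> /(_ _ _)/cvg_lim <- //.
- rewrite (_ : (fun n => _) = cst 0) ?lim_cst//; apply/funext => n.
  by rewrite mean_sin_div_trig_weight//; exact: approx_weight_offset_gt0.
- by apply: measurable_funTS; apply: continuous_measurable_fun; exact: continuous_sinM.
- by move=> t; exact: normr_sin_le1.
Qed.

Lemma green_ge0 k : 0 <= green k.
Proof.
have cv := mean_div_approx_weight_cvg (fun t => cos (k%:~R * t)).
rewrite /green -(cvg_lim _ (cv _ _))//; last 2 first.
- by apply: measurable_funTS; apply: continuous_measurable_fun; exact: continuous_cosM.
- by move=> t; exact: normr_cos_le1.
apply: limr_ge; last first.
  apply: nearW => n; apply: mean_cos_div_trig_weight_ge0 => //.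
  exact: approx_weight_offset_gt0.
apply/cvg_ex; eexists; apply: cv => [|t]; last exact: normr_cos_le1.
by apply: measurable_funTS; apply: continuous_measurable_fun; exact: continuous_cosM.
Qed.

Lemma greenN k : green (- k) = green k.
Proof.
by rewrite /green; congr mean; apply/funext => t; rewrite mulrNz mulNr cosN.
Qed.

Lemma green_equilibrium m (s : 'I_m -> int) (e : R) : injective s -> 0 < e ->
  exists p : 'I_m -> R, (forall i, 0 <= p i) /\
    forall i, 1 <= \sum_j p j * green (s i - s j) <= 1 + e.
Proof.
(* This [K] bounds every [approx_weight n], hence the equilibrium weights uniformly in [n]. *)
move=> s_inj e_gt0; pose K := 4 * limn S + 1.
have K_gt0 : 0 < K.
  by apply: lt_le_trans (approx_weight_le 0 0); exact: approx_weight_gt0.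
apply: (approximate_equilibrium _ _ _ _ _ K_gt0 e_gt0) => d d_gt0.
have : \forall n \near \oo, forall ij : 'I_m * 'I_m,
    `|green (s ij.1 - s ij.2) -
      mean (fun t => cos ((s ij.1 - s ij.2)%:~R * t) / approx_weight n t)| <= d.
  apply: filter_forall => -[i j] /=; apply: cvgr_dist_le d_gt0.
  apply: mean_div_approx_weight_cvg => [|t]; last exact: normr_cos_le1.
  by apply: measurable_funTS; apply: continuous_measurable_fun; exact: continuous_cosM.
move=> [n _ /(_ n (leqnn n))] near_n.
exists (fun k => mean (fun t => cos (k%:~R * t) / approx_weight n t)); split.
  by move=> i j; exact: (near_n (i, j)).
apply: trig_weight_equilibrium => //; first exact: approx_weight_offset_gt0.
by move=> t; exact: approx_weight_le.
Qed.

End weight.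

(** * Potentials and duality *)

Section duality.
Context {R : realType} (c : nat -> R).
Hypothesis c_ge0 : forall k, (1 <= k)%N -> 0 <= c k.
Hypothesis c_sum_fin : (\sum_(1 <= k <oo) (c k)%:E < +oo)%E.
Notation mu := lebesgue_measure.
Notation w := (weight c).
Notation g := (fun t => (weight c t)^-1).
Hypothesis w_inv : inv_integrable w.
Local Open Scope complex_scope.

Let w_ge0 t : 0 <= w t. Proof. exact: weight_ge0. Qed.

Lemma circle_eint_mean (u : R -> R) : circle_integrable u ->
  circle_eint (EFin \o u) = (mean u)%:E.
Proof.
move=> iu; rewrite /circle_eint /mean EFinM fineK//.
by apply: integrable_fin_num iu; exact: measurable_circle.
Qed.

(* Real and imaginary parts of
   [\sum_j (A j + i * B j) * expi (s j * t)]. *)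
Definition trig_re m (s : 'I_m -> int) (A B : 'I_m -> R) (t : R) : R :=
  \sum_j (A j * cos ((s j)%:~R * t) - B j * sin ((s j)%:~R * t)).
Definition trig_im m (s : 'I_m -> int) (A B : 'I_m -> R) (t : R) : R :=
  \sum_j (A j * sin ((s j)%:~R * t) + B j * cos ((s j)%:~R * t)).

Lemma cos_intB (k l : int) (t : R) : cos ((k - l)%:~R * t) =
  cos (k%:~R * t) * cos (l%:~R * t) + sin (k%:~R * t) * sin (l%:~R * t).
Proof. by rewrite intrB mulrBl cosB. Qed.

Lemma sin_intB (k l : int) (t : R) : sin ((k - l)%:~R * t) =
  sin (k%:~R * t) * cos (l%:~R * t) - cos (k%:~R * t) * sin (l%:~R * t).
Proof. by rewrite intrB mulrBl sinB. Qed.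

Let measurable_cosM (r : R) : measurable_fun circle (fun t => cos (r * t)).
Proof.
by apply: measurable_funTS; apply: continuous_measurable_fun;
  exact: continuous_cosM.
Qed.

Let measurable_sinM (r : R) : measurable_fun circle (fun t => sin (r * t)).
Proof.
by apply: measurable_funTS; apply: continuous_measurable_fun;
  exact: continuous_sinM.
Qed.

Lemma measurable_trig_re m (s : 'I_m -> int) A B :
  measurable_fun circle (trig_re m s A B).
Proof.
apply: measurable_sum => j.
by apply: measurable_funB; apply: measurable_funM.
Qed.

Lemma measurable_trig_im m (s : 'I_m -> int) A B :
  measurable_fun circle (trig_im m s A B).
Proof.
apply: measurable_sum => j.
by apply: measurable_funD; apply: measurable_funM.
Qed.

Lemma trig_norm_sq m (s : 'I_m -> int) A B t :
  trig_re m s A B t ^+ 2 + trig_im m s A B t ^+ 2 =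
  \sum_j \sum_k ((A j * A k + B j * B k) * cos ((s j - s k)%:~R * t) +
                 (A j * B k - B j * A k) * sin ((s j - s k)%:~R * t)).
Proof.
rewrite !expr2 /trig_re /trig_im !big_distrlr/= -big_split/=.
apply: eq_bigr => j _; rewrite -big_split/=; apply: eq_bigr => k _.
by rewrite cos_intB sin_intB; ring.
Qed.

Let cos_int k : circle_integrable (fun t => cos (k%:~R * t) * g t).
Proof.
by apply: circle_integrable_invwM => //; exists 1 => t; exact: normr_cos_le1.
Qed.

Let sin_int k : circle_integrable (fun t => sin (k%:~R * t) * g t).
Proof.
by apply: circle_integrable_invwM => //; exists 1 => t; exact: normr_sin_le1.
Qed.

(** The squared norm of a trigonometric polynomial with respect to [1 / w] is the Green energy of
    its coefficients; the sine terms average to zero. *)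
Lemma mean_trig_norm_sq m (s : 'I_m -> int) A B :
  let u t := (trig_re m s A B t ^+ 2 + trig_im m s A B t ^+ 2) * g t in
  circle_integrable u /\
  mean u = \sum_j \sum_k (A j * A k + B j * B k) * green c (s j - s k).
Proof.
move=> u; pose v j k t :=
  (A j * A k + B j * B k) * (cos ((s j - s k)%:~R * t) * g t) +
  (A j * B k - B j * A k) * (sin ((s j - s k)%:~R * t) * g t).
have v_int j k : circle_integrable (v j k).
  by apply: circle_integrableD; exact: circle_integrableZ.
have uE : u = fun t => \sum_j \sum_k v j k t.
  apply/funext => t; rewrite /u trig_norm_sq mulr_suml; apply: eq_bigr => j _.
  by rewrite mulr_suml; apply: eq_bigr => k _; rewrite /v; ring.
rewrite uE; split.
  by apply: circle_integrable_sum => j; exact: circle_integrable_sum.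
rewrite mean_sum => [|j]; last exact: circle_integrable_sum.
apply: eq_bigr => j _; rewrite mean_sum//; apply: eq_bigr => k _.
rewrite /v meanD ?meanZ ?mean_sin_invw ?mulr0 ?addr0//; exact: circle_integrableZ.
Qed.

Lemma normc_sq (z : R[i]) : Normc.normc z ^+ 2 = complex.Re z ^+ 2 + complex.Im z ^+ 2.
Proof. by case: z => a b /=; rewrite sqr_sqrtr// addr_ge0 ?sqr_ge0. Qed.

(** The pair [u] is the phase of [z]; it makes the modulus of a Fourier coefficient linear in
    [f]. *)
Lemma normc_unit_combination (z : R[i]) : exists u : R * R,
  u.1 ^+ 2 + u.2 ^+ 2 = 1 /\
  Normc.normc z = u.1 * complex.Re z + u.2 * complex.Im z.
Proof.
have := normc_sq z; move: (Normc.normc z) (complex.Re z) (complex.Im z).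
move=> r x y rE; have [r0|r0] := eqVneq r 0.
  exists (1, 0) => /=; split; first by rewrite expr1n expr0n addr0.
  have : x ^+ 2 <= r ^+ 2 by rewrite rE lerDl sqr_ge0.
  rewrite r0 expr0n le_eqVlt ltNge sqr_ge0 orbF sqrf_eq0 => /eqP ->.
  by rewrite mulr0 mul0r addr0.
exists (x / r, y / r) => /=; split.
  by rewrite !expr_div_n -mulrDl -rE divff// sqrf_eq0.
by apply: (mulfI r0); rewrite -expr2 rE; field.
Qed.

Lemma fourier_re (f : R -> R[i]) (k : int) : complex.Re (fourier f k) = mean (fun t =>
  complex.Re (f t) * cos (k%:~R * t) + complex.Im (f t) * sin (k%:~R * t)).
Proof.
rewrite /fourier /circle_int /mean/=; congr (_ * _).
by apply: eq_Rintegral => t _; case: (f t) => a b /=; ring.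
Qed.

Lemma fourier_im (f : R -> R[i]) (k : int) : complex.Im (fourier f k) = mean (fun t =>
  complex.Im (f t) * cos (k%:~R * t) - complex.Re (f t) * sin (k%:~R * t)).
Proof.
rewrite /fourier /circle_int /mean/=; congr (_ * _).
by apply: eq_Rintegral => t _; case: (f t) => a b /=; ring.
Qed.

(** Take [f] to be [g] times the polynomial with coefficients [p]. Its squared norm is the energy of
    [p] because [g ^+ 2 * w = g], including where [w] vanishes, as [g] is 0 there. *)
Lemma exists_potential m (s : 'I_m -> int) (p : 'I_m -> R) :
  exists f : R -> R[i], [/\ L2w w f,
    forall k, fourier f k = (\sum_j p j * green c (k - s j))%:C &
    L2w_norm_sq w f = (\sum_j \sum_k p j * p k * green c (s j - s k))%:E].
Proof.
pose O := (fun _ => 0) : 'I_m -> R.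
pose f t := (trig_re m s p O t * g t) +i* (trig_im m s p O t * g t).
have [u_int u_mean] := mean_trig_norm_sq m s p O.
have norm_f : L2w_norm_sq w f = (\sum_j \sum_k p j * p k * green c (s j - s k))%:E.
  rewrite (_ : \sum_j _ =
      \sum_j \sum_k (p j * p k + O j * O k) * green c (s j - s k)); last first.
    apply: eq_bigr => j _; apply: eq_bigr => k _.
    by rewrite /O mulr0 addr0.
  rewrite -u_mean -circle_eint_mean//; congr circle_eint; apply/funext => t /=.
  rewrite sqr_sqrtr ?addr_ge0 ?sqr_ge0//; congr EFin.
  have [w0|w0] := eqVneq (w t) 0; first by rewrite w0 invr0 !mulr0.
  by field.
exists f; split=> //.
- split; last by rewrite norm_f ltry.
  by split; apply: measurable_funM; rewrite /f/=;
    [exact: measurable_trig_re|exact: measurable_invw|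
     exact: measurable_trig_im|exact: measurable_invw].
- move=> k; apply/eqP; rewrite eq_complex fourier_re fourier_im; apply/andP; split.
  + apply/eqP; rewrite /f/=.
    rewrite (_ : (fun t => _) = fun t =>
        \sum_j p j * (cos ((k - s j)%:~R * t) * g t)).
      rewrite mean_sum => [|j]; last exact: circle_integrableZ.
      by apply: eq_bigr => j _; rewrite meanZ.
    apply/funext => t; rewrite /trig_re /trig_im !mulr_suml -big_split/=.
    by apply: eq_bigr => j _; rewrite cos_intB /O; ring.
  + apply/eqP; rewrite /f/=.
    rewrite (_ : (fun t => _) = fun t =>
        \sum_j - p j * (sin ((k - s j)%:~R * t) * g t)).
      rewrite mean_sum => [|j]; last exact: circle_integrableZ.
      by rewrite big1// => j _; rewrite meanZ// mean_sin_invw// mulr0.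
    apply/funext => t; rewrite /trig_re /trig_im !mulr_suml -sumrB.
    by apply: eq_bigr => j _; rewrite sin_intB /O; ring.
Qed.

(** The factor [W * W^-1] is the indicator of [W != 0], so the inequality also covers zeros of the
    weight. *)
Lemma weighted_AMGM (W th x y : R) : 0 <= W -> 0 < th ->
  2 * (W * W^-1) * (x * y) <= th * (x ^+ 2 * W) + th^-1 * (y ^+ 2 * W^-1).
Proof.
move=> W_ge0 th_gt0; have [->|W0] := eqVneq W 0.
  by rewrite invr0 !mulr0 mul0r addr0.
have W_gt0 : 0 < W by rewrite lt_neqAle eq_sym W0.
rewrite -subr_ge0.
have -> : th * (x ^+ 2 * W) + th^-1 * (y ^+ 2 / W) - 2 * (W / W) * (x * y) =
  (th * W * x - y) ^+ 2 / (th * W) by field; rewrite W0 gt_eqF.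
by rewrite divr_ge0 ?sqr_ge0// ltW// mulr_gt0.
Qed.

(** * Duality between the weighted norm and the Green energy *)

Section fourier_bound.
Context (f : R -> R[i]).
Hypothesis f_L2 : L2w w f.

Let a t := complex.Re (f t).
Let b t := complex.Im (f t).
Let N := mean (fun t => (a t ^+ 2 + b t ^+ 2) * w t).

Let ma : measurable_fun circle a. Proof. by case: f_L2 => -[]. Qed.
Let mb : measurable_fun circle b. Proof. by case: f_L2 => -[]. Qed.
Let mw : measurable_fun circle w. Proof. exact: measurable_weight. Qed.
Let mg : measurable_fun circle g. Proof. exact: measurable_invw. Qed.

Let density_int : circle_integrable (fun t => (a t ^+ 2 + b t ^+ 2) * w t).
Proof.
apply/integrableP; split.
  apply/measurable_EFinP; apply: measurable_funM => //.
  by apply: measurable_funD; exact: measurable_funX.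
rewrite (_ : (\int[mu]_(t in circle) _)%E = (\int[mu]_(t in circle)
    ((a t ^+ 2 + b t ^+ 2) * w t)%:E)%E); last first.
  apply: eq_integral => t _ /=.
  by rewrite ger0_norm// mulr_ge0// addr_ge0 ?sqr_ge0.
case: f_L2 => _; rewrite /L2w_norm_sq /circle_eint.
under eq_integral do rewrite normc_sq.
rewrite -/a -/b; move: (integral _ _ _) => I.
case: I => [r _| |_]; [exact: ltry| |by []].
by rewrite gt0_muley ?lte_fin ?invr_gt0 ?twopi_gt0.
Qed.

Lemma L2w_norm_sqE : L2w_norm_sq w f = N%:E.
Proof.
rewrite -circle_eint_mean//; congr circle_eint; apply/funext => t.
by rewrite normc_sq.
Qed.

(** Multiplication by the indicator of [w t != 0], which changes no mean and prepares for
    [weighted_AMGM]. *)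
Let cut (u : R -> R) t := w t * g t * u t.

Let mean_cut u : measurable_fun circle u -> mean u = mean (cut u).
Proof.
move=> mu_; apply: mean_ae_eq => //.
  by do 2 ?apply: measurable_funM.
apply: (@filterS _ _ (ae_filter_ringOfSetsType mu)) (weight_neq0_ae c w_inv).
by move=> t /[apply] w0; rewrite /cut divff// mul1r.
Qed.

(** This is the inclusion of L2(w) in L1: [w * g * |z|] is at most half of [z ^+ 2 * w + g], and
    both terms are integrable. *)
Let cut_int (x y : R -> R) : measurable_fun circle x -> measurable_fun circle y ->
  (forall t, `|x t| <= 1) -> (forall t, `|y t| <= 1) ->
  circle_integrable (cut (fun t => a t * x t + b t * y t)).
Proof.
move=> mx my x1 y1.
apply: (@circle_integrable_le _ _
  (fun t => (a t ^+ 2 + b t ^+ 2) * w t + cst 1 t * g t)).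
- apply: measurable_funM; first exact: measurable_funM.
  by apply: measurable_funD; exact: measurable_funM.
- apply: circle_integrableD => //; apply: circle_integrable_invwM => //.
  by exists 1 => t; rewrite normr1.
move=> t; have wg_ge0 : 0 <= w t * g t by rewrite mulr_ge0 ?invr_ge0.
have half z y' : `|y'| <= 1 -> w t * g t * `|z * y'| <=
    2^-1 * (z ^+ 2 * w t) + 2^-1 * g t.
  move=> y'1; have := @weighted_AMGM (w t) 1 `|z| 1 (w_ge0 t) ltr01.
  rewrite invr1 real_normK ?num_real// expr1n !mul1r mulr1 => h.
  have : w t * g t * `|z * y'| <= w t * g t * `|z|.
    by rewrite ler_wpM2l// normrM ler_piMr.
  by move: h; move: (w t * g t) => q; nra.
rewrite /cut normrM ger0_norm//.
apply: le_trans (ler_wpM2l wg_ge0 (ler_normD _ _)) _.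
rewrite mulrDr; apply: le_trans (lerD (half _ _ (x1 t)) (half _ _ (y1 t))) _.
have aw : 0 <= a t ^+ 2 * w t by rewrite mulr_ge0 ?sqr_ge0.
have bw : 0 <= b t ^+ 2 * w t by rewrite mulr_ge0 ?sqr_ge0.
rewrite /= mul1r mulrDl; lra.
Qed.

(** The phases of the Fourier coefficients are absorbed into the coefficients [A], [B] of a
    trigonometric polynomial. Pairing it with [f] and applying AM-GM pointwise gives the bound with
    these phases in the energy. *)
Lemma fourier_dual_bound m (s : 'I_m -> int) (M : 'I_m -> R) (th : R) :
  (forall j, 0 <= M j) -> 0 < th ->
  2 * \sum_j M j * Normc.normc (fourier f (s j)) <=
  th * N + th^-1 * \sum_j \sum_k M j * M k * green c (s j - s k).
Proof.
move=> M_ge0 th_gt0; set x := fun j => fourier f (s j).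
have /choice[z zP] j := normc_unit_combination (x j).
pose A j := M j * (z j).1; pose B j := M j * (z j).2.
pose P := trig_re m s A B; pose Q := trig_im m s A B.
pose X j t := cut (fun t =>
  a t * cos ((s j)%:~R * t) + b t * sin ((s j)%:~R * t)) t.
pose Y j t := cut (fun t =>
  a t * - sin ((s j)%:~R * t) + b t * cos ((s j)%:~R * t)) t.
have X_int j : circle_integrable (X j).
  by apply: cut_int => // t; [exact: normr_cos_le1|exact: normr_sin_le1].
have Y_int j : circle_integrable (Y j).
  apply: cut_int => // [|t|t]; last exact: normr_cos_le1.
    exact: measurable_funN.
  by rewrite normrN normr_sin_le1.
have xX j : complex.Re (x j) = mean (X j).
  rewrite /x fourier_re mean_cut//.
  by apply: measurable_funD; exact: measurable_funM.
have xY j : complex.Im (x j) = mean (Y j).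
  rewrite /x fourier_im mean_cut; last first.
    by apply: measurable_funB; exact: measurable_funM.
  by congr mean; apply/funext => t; rewrite /Y /cut /a /b; ring.
have sumE : \sum_j M j * Normc.normc (x j) =
    mean (fun t => w t * g t * (a t * P t + b t * Q t)).
  transitivity (mean (fun t => \sum_j (A j * X j t + B j * Y j t))).
    rewrite mean_sum => [|j]; last first.
      by apply: circle_integrableD; exact: circle_integrableZ.
    apply: eq_bigr => j _; rewrite meanD ?meanZ//; try exact: circle_integrableZ.
    by have [_ ->] := zP j; rewrite -xX -xY /A /B; ring.
  congr mean; apply/funext => t; rewrite /P /Q /trig_re /trig_im.
  rewrite !mulr_sumr -big_split/= mulr_sumr; apply: eq_bigr => j _.
  by rewrite /X /Y /cut; ring.
have [PQ_int PQ_mean] := mean_trig_norm_sq m s A B.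
have sum_int : circle_integrable (fun t => w t * g t * (a t * P t + b t * Q t)).
  rewrite (_ : (fun t => _) = fun t => \sum_j (A j * X j t + B j * Y j t)).
    apply: circle_integrable_sum => j.
    by apply: circle_integrableD; exact: circle_integrableZ.
  apply/funext => t; rewrite /P /Q /trig_re /trig_im.
  rewrite !mulr_sumr -big_split/= mulr_sumr; apply: eq_bigr => j _.
  by rewrite /X /Y /cut; ring.
have mean_bound : 2 * \sum_j M j * Normc.normc (x j) <= th * N +
    th^-1 * \sum_j \sum_k (A j * A k + B j * B k) * green c (s j - s k).
  rewrite sumE -PQ_mean -!meanZ// -meanD; [|exact: circle_integrableZ..].
  apply: mean_le; [exact: circle_integrableZ| |].
    by apply: circle_integrableD; exact: circle_integrableZ.
  move=> t; have := @weighted_AMGM (w t) th (a t) (P t) (w_ge0 t) th_gt0.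
  have := @weighted_AMGM (w t) th (b t) (Q t) (w_ge0 t) th_gt0.
  rewrite -/P -/Q !mulrDr !mulrDl !mulrDr; rewrite !mulrA; lra.
(* Two unit phases have inner product at most 1, so [green >= 0] lets the phases be dropped from the
   energy. *)
apply: le_trans mean_bound _; rewrite lerD2l ler_wpM2l ?invr_ge0 ?(ltW th_gt0)//.
apply: ler_sum => j _; apply: ler_sum => k _.
rewrite ler_wpM2r ?green_ge0//.
have -> : A j * A k + B j * B k =
  M j * M k * ((z j).1 * (z k).1 + (z j).2 * (z k).2) by rewrite /A /B; ring.
rewrite ler_piMr ?mulr_ge0//.
have [zj _] := zP j; have [zk _] := zP k.
have := sqr_ge0 ((z j).1 - (z k).1); have := sqr_ge0 ((z j).2 - (z k).2).
by rewrite !sqrrB; lra.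
Qed.

End fourier_bound.
End duality.

(** * Capacities *)

(** Nonemptiness matters for [C = 0]: the infimum of the empty set is [+oo], and its product with 0
    is 0. *)
Lemma le_mule_ereal_inf {R : realType} (C : R) (y : \bar R) (A : set (\bar R)) :
  0 <= C -> A !=set0 -> (forall z, A z -> (y <= C%:E * z)%E) ->
  (y <= C%:E * ereal_inf A)%E.
Proof.
move=> C_ge0 [z Az] yA; have [C0|C0] := eqVneq C 0.
  by have := yA z Az; rewrite C0 !mul0e.
rewrite -ereal_inf_pZl; last by rewrite lt_neqAle eq_sym C0.
by apply: le_ereal_inf_tmp => _ [x Ax <-]; exact: yA.
Qed.

Lemma normc_ge1 {R : realType} (z : R[i]) : 1 <= z -> 1 <= Normc.normc z.
Proof.
case: z => a b; rewrite lecE/= => /andP[/eqP -> a1].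
by rewrite expr0n addr0 sqrtr_sqr (le_trans a1)// ler_norm.
Qed.

Lemma le_of_all_eps {R : realType} (T K : R) : 0 <= K ->
  (forall e, 0 < e -> T <= K * (1 + e) ^+ 2) -> T <= K.
Proof.
move=> K_ge0 TK; apply/ler_addgt0Pr => d d_gt0.
(* Since [e <= 1], [K * (1 + e) ^+ 2 <= K + 3 * K * e], and the choice of [e] makes
   [3 * K * e <= d]. *)
have D_gt0 : 0 < 3 * K + d by lra.
pose e := d / (3 * K + d).
have e_gt0 : 0 < e by rewrite divr_gt0.
have eE : e * (3 * K + d) = d by rewrite divfK// gt_eqF.
have e_le1 : e <= 1 by rewrite ler_pdivrMr//; lra.
apply: le_trans (TK e e_gt0) _.
have : K * (e * e) <= K * e by rewrite ler_wpM2l// ler_piMr// ltW.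
have : 0 <= e * d by rewrite mulr_ge0 ?ltW.
move: eE; rewrite mulrDr; nra.
Qed.

Section capacity_bounds.
Context {R : realType} (c : nat -> R).
Hypothesis c_ge0 : forall k, (1 <= k)%N -> 0 <= c k.
Hypothesis c_sum_fin : (\sum_(1 <= k <oo) (c k)%:E < +oo)%E.
Notation w := (weight c).
Hypothesis w_inv : inv_integrable w.
Local Open Scope complex_scope.

(** The equilibrium measure of the points indexed by [P], extended by zero so that all level sets
    share the index type ['I_m]. *)
Lemma green_equilibrium_in m (s : 'I_m -> int) (P : {pred 'I_m}) (e : R) :
  injective s -> 0 < e -> exists p : 'I_m -> R,
  [/\ forall j, 0 <= p j, forall j, j \notin P -> p j = 0 &
      forall i, i \in P -> 1 <= \sum_j p j * green c (s i - s j) <= 1 + e].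
Proof.
move=> s_inj e_gt0.
have sP_inj : injective (fun i : 'I_#|P| => s (enum_val i)).
  by move=> i j /s_inj /enum_val_inj.
have [q [q_ge0 qP]] := green_equilibrium _ c_ge0 c_sum_fin w_inv _ _ _ sP_inj e_gt0.
exists (fun j => \sum_i q i * (j == enum_val i)%:R); split.
- by move=> j; apply: sumr_ge0 => i _; rewrite mulr_ge0.
- move=> j jP; apply: big1 => i _; case: eqP => [jE|_]; last by rewrite mulr0.
  by move: jP; rewrite jE enum_valP.
- move=> i iP; have iE := enum_rankK_in iP iP.
  rewrite [X in _ <= X <= _](_ : _ =
    \sum_k q k * green c (s (enum_val (enum_rank_in iP i)) - s (enum_val k))).
    exact: qP.
  rewrite iE.
  under eq_bigr do rewrite mulr_suml.
  rewrite exchange_big/=; apply: eq_bigr => k _.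
  rewrite (bigD1 (enum_val k))//= eqxx mulr1 big1 ?addr0// => j jk.
  by rewrite (negPf jk) mulr0 mul0r.
Qed.

(** The potential of [p] is itself a competitor, with squared norm the energy of [p]. *)
Lemma capacity_le_energy m (s : 'I_m -> int) (P : {pred 'I_m}) (p : 'I_m -> R) :
  (forall i, i \in P -> 1 <= \sum_j p j * green c (s i - s j)) ->
  (capacity w [set` [seq s i | i in P]] <=
   (\sum_j \sum_k p j * p k * green c (s j - s k))%:E)%E.
Proof.
move=> pP; have [f [f_L2 f_fourier f_norm]] :=
  exists_potential c c_ge0 c_sum_fin w_inv m s p.
rewrite -f_norm; apply: ge_ereal_inf; exists (Dnorm_sq w (fourier f)).
  exists (fourier f) => //; split; first by exists f.
  move=> _ /= /fintype.imageP[i iP ->]; rewrite f_fourier lecE/= eqxx/=.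
  exact: pP.
by apply: ereal_inf_lbound; exists f.
Qed.

(** An equilibrium potential supplies the competitor, so the infimum defining the capacity of a
    finite set is over a nonempty set. *)
Lemma exists_ge1_on (J : set int) : finite_set J ->
  exists2 x, Dspace w x & forall j, J j -> 1 <= x j.
Proof.
move=> J_fin; pose r : seq int := finmap.enum_fset (fset_set J).
have r_uniq : uniq r by exact: finmap.fset_uniq.
pose s (i : 'I_(size r)) := nth 0 r i.
have s_inj : injective s.
  move=> i j /eqP; rewrite /s nth_uniq// => /eqP; exact: val_inj.
have [p [_ pP]] :=
  green_equilibrium _ c_ge0 c_sum_fin w_inv _ _ _ s_inj ltr01.
have [f [f_L2 f_fourier _]] :=
  exists_potential c c_ge0 c_sum_fin w_inv _ s p.
exists (fourier f); first by exists f.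
move=> j Jj; have jr : j \in r by rewrite /r in_fset_set// inE.
have jlt : (index j r < size r)%N by rewrite index_mem.
have := pP (Ordinal jlt); rewrite {1}/s/= nth_index// => /andP[h _].
by rewrite f_fourier lecE/= eqxx.
Qed.

Lemma L2w_norm_sq_ge f : L2w w f -> 1 <= fourier f 0 ->
  ((green c 0 + 1)^-1%:E <= L2w_norm_sq w f)%E.
Proof.
move=> f_L2 f0; rewrite L2w_norm_sqE// lee_fin.
have G_ge0 := green_ge0 c c_ge0 c_sum_fin w_inv 0.
have G_gt0 : 0 < green c 0 + 1 by lra.
(* One point of mass 1 and [th = green c 0 + 1] give [2 <= th * N + 1]; the added 1 keeps [th]
   positive. *)
have := fourier_dual_bound c c_ge0 c_sum_fin w_inv f f_L2 1
  (fun=> 0) (fun=> 1) (green c 0 + 1) (fun=> ler01) G_gt0.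
rewrite !big_ord1 !mul1r subrr; move: (mean _) => N.
have := normc_ge1 _ f0; move: (Normc.normc _) => x x1.
have : (green c 0 + 1)^-1 * green c 0 <= 1.
  by rewrite mulrC ler_pdivrMr// mul1r lerDl.
rewrite -[_^-1 <= N](ler_pM2l G_gt0) divff ?gt_eqF//; lra.
Qed.

Lemma Dnorm_sq_ge x : 1 <= x 0 -> ((green c 0 + 1)^-1%:E <= Dnorm_sq w x)%E.
Proof.
move=> x0; apply: le_ereal_inf_tmp => _ [f [f_L2 fx] <-].
by apply: L2w_norm_sq_ge => //; rewrite fx.
Qed.

Lemma green0D1_gt0 : 0 < green c 0 + 1.
Proof.
by have := green_ge0 c c_ge0 c_sum_fin w_inv 0; lra.
Qed.

Lemma ge0_of_mule (C : R) (y : \bar R) (d : R) : 0 < d ->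
  (d%:E <= y)%E -> (0 <= C%:E * y)%E -> 0 <= C.
Proof.
move=> d_gt0 dy; have y_gt0 : (0 < y)%E by apply: lt_le_trans dy; rewrite lte_fin.
by rewrite leNgt => Cy; rewrite leNgt; apply: contra Cy => C_lt0;
  rewrite mule_lt0_gt0 ?lte_fin.
Qed.

Context (nu : int -> R).
Hypothesis nu_ge0 : forall k, 0 <= nu k.

(** Constants range over all reals; testing on [[set 0]], whose capacity is positive, excludes
    negative ones. *)
Lemma capacity_ineq_constant_ge0 C : capacity_ineq w nu C -> 0 <= C.
Proof.
move=> capC; have := capC [set 0] (finite_set1 0); rewrite fsbig_set1 => h.
apply: (@ge0_of_mule _ (capacity w [set 0]) (green c 0 + 1)^-1).
- by rewrite invr_gt0 green0D1_gt0.
- apply: le_ereal_inf_tmp => _ [x [_ x0] <-].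
  by apply: Dnorm_sq_ge; exact: x0.
- by apply: le_trans h; rewrite lee_fin.
Qed.

Lemma embedding_ineq_constant_ge0 C : embedding_ineq w nu C -> 0 <= C.
Proof.
move=> embC; have [x xD x0] := exists_ge1_on _ (finite_set1 (0 : int)).
apply: (@ge0_of_mule _ (Dnorm_sq w x) (green c 0 + 1)^-1).
- by rewrite invr_gt0 green0D1_gt0.
- by apply: Dnorm_sq_ge; exact: x0.
- apply: le_trans (embC x xD); apply: esum_ge0 => k _.
  by rewrite lee_fin mulr_ge0 ?sqr_ge0.
Qed.

Lemma embedding_capacity C : embedding_ineq w nu C -> capacity_ineq w nu C.
Proof.
move=> embC J J_fin; apply: le_mule_ereal_inf.
- exact: embedding_ineq_constant_ge0 embC.
- have [x xD xJ] := exists_ge1_on _ J_fin.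
  by exists (Dnorm_sq w x); exists x.
move=> _ [x [xD xJ] <-]; apply: le_trans (embC x xD).
apply: esum_ge; exists J; first by split.
rewrite fsumEFin// lee_fin !fsbig_finite//=.
rewrite !big_seq; apply: ler_sum => k; rewrite in_fset_set// inE => Jk.
by rewrite ler_peMl// exprn_ege1// normc_ge1// xJ.
Qed.

(** Sorting the indices by modulus turns the superlevel sets into final segments, to which the
    strong capacitary inequality applies; then [e] tends to 0. *)
Lemma finite_embedding C f (r : seq int) : capacity_ineq w nu C -> L2w w f ->
  uniq r ->
  ((\sum_(k <- r) Normc.normc (fourier f k) ^+ 2 * nu k)%:E <=
    (4 * C)%:E * L2w_norm_sq w f)%E.
Proof.
move=> capC f_L2 r_uniq; have C_ge0 := capacity_ineq_constant_ge0 _ capC.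
pose size_x k := Normc.normc (fourier f k).
pose leT k l := size_x k <= size_x l.
pose r' := sort leT r; pose m := size r'.
have leT_total : total leT by move=> k l; exact: le_total.
have leT_trans : transitive leT by move=> k l h; exact: le_trans.
have r'_sorted : sorted leT r' by exact: sort_sorted.
have r'_uniq : uniq r' by rewrite sort_uniq.
rewrite (perm_big r') ?perm_sort//= ?(perm_sym r) ?perm_sort//.
rewrite (big_nth 0) big_mkord -/m.
pose s (i : 'I_m) := nth 0 r' i.
have s_inj : injective s.
  by move=> i j /eqP; rewrite /s nth_uniq// => /eqP; exact: val_inj.
rewrite L2w_norm_sqE//; move NE : (mean _) => N.
rewrite -EFinM lee_fin.
have dual M th := fourier_dual_bound c c_ge0 c_sum_fin w_inv f f_L2 m s M th.
rewrite NE in dual.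
have N_ge0 : 0 <= N.
  rewrite -lee_fin -NE -L2w_norm_sqE//.
  rewrite /L2w_norm_sq /circle_eint mule_ge0 ?lee_fin ?invr_ge0 ?(ltW twopi_gt0)//.
  by apply: integral_ge0 => t _; rewrite lee_fin mulr_ge0 ?sqr_ge0// weight_ge0.
apply: le_of_all_eps => [|e e_gt0]; first by rewrite !mulr_ge0.
have /choice[q qP] i :=
  green_equilibrium_in m s [pred j : 'I_m | (i <= j)%N] e s_inj e_gt0.
(* Extension by zero from ['I_m] to [nat], the index type of [strong_capacitary_inequality]. *)
pose ext (u : 'I_m -> R) (j : nat) := odflt 0 (omap u (insub j)).
have extE u (j : 'I_m) : ext u j = u j by rewrite /ext valK.
have -> : 4 * C * N * (1 + e) ^+ 2 = 4 * C * (1 + e) ^+ 2 * N by ring.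
apply: (@strong_capacitary_inequality R m (fun j => size_x (nth 0 r' j))
  (fun j => nu (nth 0 r' j)) (fun i j => green c (nth 0 r' i - nth 0 r' j))
  (fun i => ext (q i)) e C N) => //.
- exact: ltW.
- move=> i im; have size_x_ge0 k : 0 <= size_x k.
    by rewrite /size_x; case: (fourier f k) => a b; exact: sqrtr_ge0.
  case: i im => [|i] im; first by rewrite /= lexx size_x_ge0.
  rewrite /= size_x_ge0/=; apply: (sorted_leq_nth leT_trans) => //.
  + by move=> k; exact: lexx.
  + by rewrite inE -/m ltnW.
- move=> i j /andP[ij jm]; apply: (sorted_leq_nth leT_trans) => //.
  + by move=> k; exact: lexx.
  + by rewrite inE -/m (leq_ltn_trans ij).
- by move=> i j; rewrite -greenN opprB.
- move=> i j; rewrite /ext; case: insubP => //= k _ _.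
  by have [q_ge0 _ _] := qP i.
- move=> i j ji; rewrite /ext; case: insubP => //= k _ kj.
  by have [_ q0 _] := qP i; rewrite q0// inE kj -ltnNge.
- move=> i j /andP[ij jm]; have [_ _ /(_ (Ordinal jm) ij)/andP[_]] := qP i.
  by apply: le_trans; rewrite le_eqVlt; apply/orP; left; apply/eqP;
    apply: eq_bigr => k _; rewrite extE.
- by move=> M th M_ge0 th_gt0; apply: dual.
- move=> i im; have [q_ge0 _ q_pot] := qP i.
  have q_pot1 j : j \in [pred j : 'I_m | (i <= j)%N] ->
      1 <= \sum_k q i k * green c (s j - s k).
    by move=> /q_pot/andP[].
  have J_uniq : uniq [seq s j | j : 'I_m in [pred j : 'I_m | (i <= j)%N]].
    by rewrite map_inj_uniq// enum_uniq.
  have := capC _ (finite_seq [seq s j | j : 'I_m in [pred j : 'I_m | (i <= j)%N]]).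
  rewrite -fsbig_seq// big_map big_enum/= => h.
  have C_ge0E : (0 <= C%:E)%E by rewrite lee_fin.
  have := le_trans h (lee_wpmul2l C_ge0E (capacity_le_energy m s _ _ q_pot1)).
  rewrite -EFinM lee_fin => {}h.
  apply: le_trans h _; rewrite ler_wpM2l//.
  rewrite le_eqVlt; apply/orP; left; apply/eqP.
  by apply: eq_bigr => j _; apply: eq_bigr => k _; rewrite !extE.
Qed.

(** The sum over all integers is the supremum of its finite partial sums, and the norm is an infimum
    over representatives [f]; each such pair is covered by [finite_embedding]. *)
Lemma capacity_embedding C : capacity_ineq w nu C -> embedding_ineq w nu (4 * C).
Proof.
move=> capC x [f0 f0_L2 f0x]; apply: le_mule_ereal_inf.
- by rewrite mulr_ge0// (capacity_ineq_constant_ge0 _ capC).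
- by exists (L2w_norm_sq w f0); exists f0.
move=> _ [f [f_L2 fx] <-]; apply: ge_ereal_sup => _ [X [X_fin _] <-].
rewrite fsumEFin// fsbig_finite//= -fx.
by apply: finite_embedding => //; exact: finmap.fset_uniq.
Qed.

End capacity_bounds.

Theorem theorem4p3 (R : realType) (c : nat -> R)
  (c_ge0 : forall k : nat, (1 <= k)%N -> 0 <= c k)
  (c_sum_gt0 : (0 < \sum_(1 <= k <oo) (c k)%:E)%E)
  (c_sum_fin : (\sum_(1 <= k <oo) (c k)%:E < +oo)%E)
  (w_inv : inv_integrable (weight c))
  (nu : int -> R) (nu_ge0 : forall k : int, 0 <= nu k) :
  ((exists C : R, embedding_ineq (weight c) nu C) <->
   (exists C1 : R, capacity_ineq (weight c) nu C1)) /\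
  (best_constant (capacity_ineq (weight c) nu)
     <= best_constant (embedding_ineq (weight c) nu))%E /\
  (best_constant (embedding_ineq (weight c) nu)
     <= 4%:E * best_constant (capacity_ineq (weight c) nu))%E.
Proof.
have cap_emb := @embedding_capacity R c c_ge0 c_sum_fin w_inv nu nu_ge0.
have emb_cap := @capacity_embedding R c c_ge0 c_sum_fin w_inv nu nu_ge0.
split; [split=> -[C hC]|split].
- by exists C; exact: cap_emb.
- by exists (4 * C); exact: emb_cap.
- by apply: ereal_inf_le_tmp => _ [C hC <-]; exists C => //; exact: cap_emb.
- rewrite /best_constant -ereal_inf_pZl//.
  apply: le_ereal_inf_tmp => _ [_ [C hC <-] <-].
  by apply: ereal_inf_lbound; exists (4 * C); [exact: emb_cap|rewrite EFinM].
Qed.
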